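(* Let $T:\mathscr B(\ell^2(\mathbb N_0))\to\mathscr B(\ell^2(\mathbb N_0))$ be a quantum birth and death chain with transition rates $\lambda_n,\mu_n,\eta_n$. 1. Suppose that $\lambda_k\neq 0$ for all $k\ge 0$ and $\mu_k\neq 0$ for all $k\geq 1$. Put $\pi_0:=1$, $\pi_n:=\frac{\lambda_0\lambda_1\cdots\lambda_{n-1}}{\mu_1\mu_2\cdots\mu_n}$ for $n\ge1$, and suppose that $\kappa:=\liminf_{n}\frac1n\ln(\pi_n^{-1})>0$. If $$\liminf_{n}\frac{\lambda_n\mu_{n+1}}{4|\eta_n|^2}>\frac{e^{-\kappa}}{(1-e^{-\kappa})^2},$$ then $T$ has a normal invariant state of exponential fall-off. 2. Suppose that $\lambda_n\neq0$ for all $n\in\mathbb N$ and that there is $m\in\mathbb N$ such that $\mu_n<\lambda_n$ for all $n>m$. If $$\liminf_{n}\frac{(\lambda_n-\mu_n)(\lambda_{n+1}-\mu_{n+1})}{4|\eta_n|^2}>1,$$ then $T$ has no normal invariant state.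
   Context: $\mathbb N=\{1,2,\dots\}$, $\mathbb N_0=\{0,1,2,\dots\}$. $(e_n)_{n\in\mathbb N_0}$ is the canonical orthonormal basis of $\ell^2(\mathbb N_0)$; $e_{n,m}$ is the matrix unit $e_k\mapsto\delta_{m,k}e_n$; $p_{[n,m]}$ is the orthogonal projection onto $\mathrm{span}\{e_k: n\le k\le m\}$ (zero if $n>m$). A ucp-map is a unital completely positive linear map. A quantum birth and death chain (QBDC) is a (normal) ucp-map $T:\mathscr B(\ell^2(\mathbb N_0))\to\mathscr B(\ell^2(\mathbb N_0))$ satisfying $p_{[n+1,m-1]}\le T(p_{[n,m]})\le p_{[n-1,m+1]}$ for all $n,m\in\mathbb N_0$ with $n\le m$, where $p_{[-1,m+1]}$ is understood as $p_{[0,m+1]}$. Transition rates: $\lambda_n:=\mathrm{Tr}(e_{n,n}T(e_{n+1,n+1}))$ and $\eta_n:=\mathrm{Tr}(e_{n+1,n}T(e_{n,n}))$ for $n\ge0$, and $\mu_n:=\mathrm{Tr}(e_{n,n}T(e_{n-1,n-1}))$ for $n\ge1$. A state $\varphi$ is invariant for $T$ if $\varphi\circ T=\varphi$. A normal state $\varphi$ on $\mathscr B(\ell^2(\mathbb N_0))$ is of exponential fall-off if there are constants $C,\gamma>0$ with $\varphi(e_{n,n})\le Ce^{-\gamma n}$ for all $n\in\mathbb N_0$. Conventions: a quotient with positive numerator and denominator $4|\eta_n|^2=0$ is read as $+\infty$; if $\kappa=+\infty$, then $e^{-\kappa}=0$.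
   Formalization: In part 2, λ_n≠0 is also required at n=0: if λ_0=0 then the vector state at e_0 is always a normal invariant state (e.g. η=0, P(0,0)=1, λ_n=0.7, μ_n=0.3 for n≥1), so the claim read with ℕ={1,2,…} is false. *)

(* Defs.v *)
From HB Require Import structures.
From mathcomp Require Import all_boot all_order all_algebra.
From mathcomp Require Import complex.
From mathcomp Require Import all_classical all_reals all_analysis.
From mathcomp Require Import ring.

Set Implicit Arguments.
Unset Strict Implicit.
Unset Printing Implicit Defensive.

Import Order.TTheory GRing.Theory Num.Theory.
Import numFieldNormedType.Exports.

Local Open Scope classical_set_scope.
Local Open Scope ring_scope.
Local Open Scope complex_scope.

(* The order on R[i] is z <= w iff w - z is a nonnegative real, so 0 <= z
   contains the statement that z is real. *)

Section Ell2.
Variable R : realType.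
Local Notation C := R[i].

Definition sqmod (z : C) : R := Normc.normc z ^+ 2.

Lemma sqmodE z : sqmod z = complex.Re z ^+ 2 + complex.Im z ^+ 2.
Proof. by case: z => a b; rewrite /sqmod /= sqr_sqrtr// addr_ge0// sqr_ge0. Qed.

Lemma sqmod_ge0 z : 0 <= sqmod z. Proof. exact: sqr_ge0. Qed.

Lemma sqmodM z w : sqmod (z * w) = sqmod z * sqmod w.
Proof. by rewrite /sqmod Normc.normcM exprMn. Qed.

Lemma sqmodD_le z w : sqmod (z + w) <= 2 * sqmod z + 2 * sqmod w.
Proof.
rewrite !sqmodE; case: z w => a b [c d] /=; rewrite -subr_ge0.
have -> : 2 * (a ^+ 2 + b ^+ 2) + 2 * (c ^+ 2 + d ^+ 2) -
  ((a + c) ^+ 2 + (b + d) ^+ 2) = (a - c) ^+ 2 + (b - d) ^+ 2.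
  by ring.
by rewrite addr_ge0// sqr_ge0.
Qed.

Definition sqsummable : {pred nat -> C} :=
  fun x => `[< cvgn (series (fun k => sqmod (x k))) >].

Lemma sqsummable_comb (a : C) (x y : nat -> C) :
  cvgn (series (fun k => sqmod (x k))) ->
  cvgn (series (fun k => sqmod (y k))) ->
  cvgn (series ((2 * sqmod a) *: (fun k => sqmod (x k)) +
                2 *: (fun k => sqmod (y k)) : nat -> R)).
Proof.
move=> cx cy.
by apply: is_cvg_seriesD; apply: is_cvg_seriesZ.
Qed.

Lemma sqmod_comb_le (a z w : C) :
  sqmod (a * z + w) <= 2 * sqmod a * sqmod z + 2 * sqmod w.
Proof. by rewrite -mulrA -sqmodM; exact: sqmodD_le. Qed.

Fact sqsummable_submod : submod_closed sqsummable.
Proof.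
split=> [|a x y /asboolP cx /asboolP cy]; apply/asboolP.
  rewrite [X in series X](_ : _ = 0); last first.
    by apply/funext => k; rewrite /sqmod Normc.normc0 expr0n.
  rewrite [series _](_ : _ = cst 0); first exact: is_cvg_cst.
  by apply/funext => n; rewrite /series/= big1.
apply: (series_le_cvg _ _ _ (@sqsummable_comb a x y cx cy)) => k.
- exact: sqmod_ge0.
- exact: le_trans (sqmod_ge0 _) (sqmod_comb_le a (x k) (y k)).
- exact: sqmod_comb_le.
Qed.

HB.instance Definition _ :=
  GRing.isSubmodClosed.Build C (nat -> C) sqsummable sqsummable_submod.

Record ell2 := Ell2 { ell2_val :> nat -> C; _ : ell2_val \in sqsummable }.

HB.instance Definition _ := [isSub for ell2_val].
HB.instance Definition _ := [Choice of ell2 by <:].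
HB.instance Definition _ := [SubChoice_isSubLmodule of ell2 by <:].

Lemma ell2_cvg (x : ell2) : cvgn (series (fun k => sqmod (x k))).
Proof. by case: x => x /= /asboolP. Qed.

Definition hnorm (x : ell2) : R :=
  Num.sqrt (limn (series (fun k => sqmod (x k)))).

(* Sum of a complex series, computed on real and imaginary parts. *)
Definition csum (u : nat -> C) : C :=
  limn (series (fun k => complex.Re (u k))) +i*
  limn (series (fun k => complex.Im (u k))).

(* Conjugate-linear in the first argument. *)
Definition inner (x y : ell2) : C := csum (fun k => (x k)^* * y k).

Fact ebasis_sqsummable (n : nat) : (fun k => (k == n)%:R : C) \in sqsummable.
Proof.
apply/asboolP; apply: nondecreasing_is_cvgn.
  by apply: nondecreasing_series => k _ _; exact: sqmod_ge0.
exists 1 => _ [N _ <-]; rewrite /series/=.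
have [nN|Nn] := ltnP n N.
  rewrite (bigD1_seq n) ?mem_index_iota ?iota_uniq//= eqxx big1 ?addr0.
    by rewrite /sqmod Normc.normc1 expr1n.
  by move=> k /negPf ->; rewrite /sqmod Normc.normc0 expr0n.
rewrite big_nat_cond big1 ?ler01// => k; rewrite andbT => /andP[_ kN].
by rewrite ltn_eqF ?(leq_trans kN)// /sqmod Normc.normc0 expr0n.
Qed.

Definition ebasis (n : nat) : ell2 := Ell2 (ebasis_sqsummable n).

Lemma hnorm_ge0 x : 0 <= hnorm x. Proof. exact: sqrtr_ge0. Qed.

Lemma lim_sqmod_ge0 (x : ell2) : 0 <= limn (series (fun k => sqmod (x k))).
Proof.
apply: limr_ge; first exact: ell2_cvg.
by apply: nearW => n; apply: sumr_ge0 => k _; exact: sqmod_ge0.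
Qed.

Lemma sqr_hnorm x : hnorm x ^+ 2 = limn (series (fun k => sqmod (x k))).
Proof. by rewrite sqr_sqrtr// lim_sqmod_ge0. Qed.

Lemma hnorm_comb (a : C) (x y : ell2) :
  hnorm (a *: x + y) ^+ 2 <= 2 * sqmod a * hnorm x ^+ 2 + 2 * hnorm y ^+ 2.
Proof.
rewrite !sqr_hnorm.
have cx := @ell2_cvg x; have cy := @ell2_cvg y.
apply: (@le_trans _ _ (limn (series ((2 * sqmod a) *: (fun k => sqmod (x k)) +
                2 *: (fun k => sqmod (y k)) : nat -> R)))).
  apply: lim_series_le; [exact: ell2_cvg|exact: sqsummable_comb|].
  by move=> k; exact: sqmod_comb_le.
have cax := is_cvg_seriesZ (k := 2 * sqmod a) cx.
have cby := is_cvg_seriesZ (k := 2) cy.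
by rewrite lim_seriesD// !lim_seriesZ.
Qed.

Lemma hnorm0 : hnorm 0 = 0.
Proof.
rewrite /hnorm [series _](_ : _ = cst 0) ?lim_cst ?sqrtr0//.
apply/funext => n; rewrite /series/= big1// => k _.
by rewrite /sqmod Normc.normc0 expr0n.
Qed.

Lemma sqmod_le_hnorm (x : ell2) n : sqmod (x n) <= hnorm x ^+ 2.
Proof.
rewrite sqr_hnorm; apply: limr_ge; first exact: ell2_cvg.
exists n.+1 => // N /= nN; rewrite /series/= (bigD1_seq n) ?iota_uniq//=.
  by rewrite lerDl sumr_ge0// => k _; exact: sqmod_ge0.
by rewrite mem_index_iota.
Qed.

End Ell2.

Section BoundedOperators.
Variable R : realType.
Local Notation C := R[i].
Local Notation H := (ell2 R).

Definition bounded_linear : {pred H -> H} := fun A =>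
  `[< linear A /\ exists M : R, forall x, hnorm (A x) <= M * hnorm x >].

Fact bounded_linear_submod : submod_closed bounded_linear.
Proof.
split=> [|a A B /asboolP[lA [M AM]] /asboolP[lB [N BN]]]; apply/asboolP.
  split=> [b x y|]; first by rewrite scaler0 addr0.
  by exists 0 => x; rewrite mul0r hnorm0.
split=> [b x y|].
  rewrite [LHS](_ : _ = a *: A (b *: x + y) + B (b *: x + y))//.
  rewrite [RHS](_ : _ = b *: (a *: A x + B x) + (a *: A y + B y))//.
  rewrite lA lB !scalerDr !scalerA (mulrC b a) -!addrA; congr +%R.
  by rewrite addrCA.
exists (Num.sqrt (2 * sqmod a * M ^+ 2 + 2 * N ^+ 2)) => x.
have c0 : 0 <= 2 * sqmod a * M ^+ 2 + 2 * N ^+ 2.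
  by apply: addr_ge0; rewrite mulr_ge0 ?sqr_ge0// mulr_ge0 ?sqmod_ge0.
rewrite -(@ler_pXn2r _ 2)// ?nnegrE ?mulr_ge0 ?hnorm_ge0 ?sqrtr_ge0//.
rewrite exprMn (sqr_sqrtr c0).
apply: (le_trans (hnorm_comb a (A x) (B x))).
have -> : (2 * sqmod a * M ^+ 2 + 2 * N ^+ 2) * hnorm x ^+ 2 =
    2 * sqmod a * (M * hnorm x) ^+ 2 + 2 * (N * hnorm x) ^+ 2 by ring.
have c1 : 0 <= 2 * sqmod a by rewrite pmulr_rge0 ?sqmod_ge0.
apply: lerD; apply: ler_wpM2l => //.
  by rewrite (@ler_pXn2r R 2) ?nnegrE ?(le_trans _ (AM x)) ?hnorm_ge0.
by rewrite (@ler_pXn2r R 2) ?nnegrE ?(le_trans _ (BN x)) ?hnorm_ge0.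
Qed.

HB.instance Definition _ :=
  GRing.isSubmodClosed.Build C (H -> H) bounded_linear bounded_linear_submod.

(* B(l^2(N_0)) with its pointwise vector space structure. *)
Record bop := Bop { bop_val :> H -> H; _ : bop_val \in bounded_linear }.

HB.instance Definition _ := [isSub for bop_val].
HB.instance Definition _ := [Choice of bop by <:].
HB.instance Definition _ := [SubChoice_isSubLmodule of bop by <:].

Fact bop_linear (A : bop) : linear A.
Proof. by case: A => A /= /asboolP[]. Qed.

HB.instance Definition _ (A : bop) :=
  GRing.isLinear.Build C H H *:%R (bop_val A) (@bop_linear A).

Fact bop_bounded (A : bop) : exists M : R, forall x, hnorm (A x) <= M * hnorm x.
Proof. by case: A => A /= /asboolP[]. Qed.

Fact idop_bounded_linear : (fun x : H => x) \in bounded_linear.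
Proof. by apply/asboolP; split => //; exists 1 => x; rewrite mul1r. Qed.

Definition idop : bop := Bop idop_bounded_linear.

Fact compop_bounded_linear (A B : bop) : (fun x => A (B x)) \in bounded_linear.
Proof.
apply/asboolP; split=> [a x y|]; first by rewrite !linearP.
have [[M AM] [N BN]] := (bop_bounded A, bop_bounded B).
exists (`|M| * `|N|) => x; rewrite (le_trans (AM _))//.
rewrite (@le_trans _ _ (`|M| * hnorm (B x)))//.
  by rewrite ler_wpM2r ?hnorm_ge0 ?ler_norm.
rewrite -mulrA ler_wpM2l// (le_trans (BN _))//.
by rewrite ler_wpM2r ?hnorm_ge0 ?ler_norm.
Qed.

Definition compop (A B : bop) : bop := Bop (compop_bounded_linear A B).

Fact mxunit_bounded_linear (n m : nat) :
  (fun x : H => x m *: ebasis R n) \in bounded_linear.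
Proof.
apply/asboolP; split=> [a x y|]; first by rewrite scalerA -scalerDl.
exists (Num.sqrt (2 * hnorm (ebasis R n) ^+ 2)) => x.
have c0 : 0 <= 2 * hnorm (ebasis R n) ^+ 2 by rewrite mulr_ge0 ?sqr_ge0.
rewrite -(@ler_pXn2r _ 2)// ?nnegrE ?mulr_ge0 ?hnorm_ge0 ?sqrtr_ge0//.
rewrite exprMn (sqr_sqrtr c0) -[_ *: _]addr0.
apply: (le_trans (hnorm_comb _ _ _)).
rewrite hnorm0 expr0n mulr0 addr0.
have -> : 2 * sqmod (x m) * hnorm (ebasis R n) ^+ 2 =
    2 * hnorm (ebasis R n) ^+ 2 * sqmod (x m) by ring.
by apply: ler_wpM2l => //; exact: sqmod_le_hnorm.
Qed.

(* The matrix unit e_k |-> \delta_{m,k} e_n. *)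
Definition mxunit (n m : nat) : bop := Bop (mxunit_bounded_linear n m).

(* The orthogonal projection onto the span of the e_k with n <= k <= m. *)
Definition interval_proj (n m : nat) : bop := \sum_(n <= k < m.+1) mxunit k k.

Definition trace (A : bop) : C :=
  csum (fun k => inner (ebasis R k) (A (ebasis R k))).

Definition op_pos (A : bop) : Prop := forall x, 0 <= inner x (A x).

Definition op_le (A B : bop) : Prop := op_pos (B - A).

(* Positivity of an n x n operator matrix, acting on the n-fold direct sum of
   l^2(N_0). *)
Definition opmx_pos (n : nat) (A : 'M[bop]_n) : Prop :=
  forall x : 'I_n -> H, 0 <= \sum_i \sum_j inner (x i) (A i j (x j)).

Definition completely_positive (T : bop -> bop) : Prop :=
  forall (n : nat) (A : 'M[bop]_n), opmx_pos A -> opmx_pos (map_mx T A).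

Definition is_lub (X : Type) (le : X -> X -> Prop) (D : set X) (s : X) : Prop :=
  (forall a, D a -> le a s) /\ (forall b, (forall a, D a -> le a b) -> le s b).

Definition directed (D : set bop) : Prop :=
  D !=set0 /\
  forall A B, D A -> D B -> exists E, [/\ D E, op_le A E & op_le B E].

(* A positive map is normal if it preserves the suprema of bounded increasing
   nets of positive operators. *)
Definition normal_map (X : Type) (le : X -> X -> Prop) (f : bop -> X) : Prop :=
  forall (D : set bop) (S : bop),
    directed D -> (forall A, D A -> op_pos A) ->
    is_lub op_le D S -> is_lub le (f @` D) (f S).

Definition is_ucp (T : {linear bop -> bop}) : Prop :=
  T idop = idop /\ completely_positive T.

(* For n = 0 the truncated n.-1 = 0 gives [0, m + 1] as upper interval; for
   n = m = 0 the lower interval [1, 0] is empty, as is [1, -1]. *)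
Definition is_qbdc (T : {linear bop -> bop}) : Prop :=
  [/\ is_ucp T,
      normal_map op_le T &
      forall n m : nat, (n <= m)%N ->
        op_le (interval_proj n.+1 m.-1) (T (interval_proj n m)) /\
        op_le (T (interval_proj n m)) (interval_proj n.-1 m.+1)].

(* The traces defining rate_lambda and rate_mu are traces of products of two
   positive operators, hence real; the real part only changes the type. *)
Definition rate_lambda (T : {linear bop -> bop}) (n : nat) : R :=
  complex.Re (trace (compop (mxunit n n) (T (mxunit n.+1 n.+1)))).

(* Only defined for n >= 1; the value at n = 0 is a dummy. *)
Definition rate_mu (T : {linear bop -> bop}) (n : nat) : R :=
  if n is n'.+1 then complex.Re (trace (compop (mxunit n n) (T (mxunit n' n'))))
  else 0.

Definition rate_eta (T : {linear bop -> bop}) (n : nat) : C :=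
  trace (compop (mxunit n.+1 n) (T (mxunit n n))).

(* The sequence pi_n; pi is the constant of trigonometry. *)
Definition weight (T : {linear bop -> bop}) (n : nat) : R :=
  (\prod_(0 <= k < n) rate_lambda T k) / (\prod_(1 <= k < n.+1) rate_mu T k).

(* The term n = 0 is a dummy (0^-1 = 0), invisible to the lower limit. *)
Definition kappa (T : {linear bop -> bop}) : \bar R :=
  limn_einf (fun n => (n%:R^-1 * ln ((weight T n)^-1))%:E).

Definition is_state (phi : {scalar bop}) : Prop :=
  phi idop = 1 /\ forall A, op_pos A -> 0 <= phi A.

Definition is_normal_state (phi : {scalar bop}) : Prop :=
  is_state phi /\ normal_map (fun z w : C => z <= w) phi.

Definition invariant_state (T : {linear bop -> bop}) (phi : {scalar bop}) : Prop :=
  forall A, phi (T A) = phi A.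

Definition exponential_falloff (phi : {scalar bop}) : Prop :=
  exists c g : R, [/\ 0 < c, 0 < g &
    forall n : nat, phi (mxunit n n) <= (c * expR (- g * n%:R))%:C].

End BoundedOperators.

(* Main.v *)
(* Stationarity of a state on T(p_[0,n]), which differs from p_[0,n] only by a
   block on {n, n+1}, says that for x_n = phi(e_nn) the classical flow
   lam_n x_n - mu_{n+1} x_{n+1} equals a coherent term, at most
   2 |eta_n| sqrt(x_n x_{n+1}) in absolute value.

   In part 2 this makes (lam_n + mu_n) x_n eventually nondecreasing; as it tends
   to 0, x vanishes eventually, then everywhere, contradicting normality.

   In part 1 it gives q mu_{n+1} x_{n+1} <= lam_n x_n for some q > exp(- kappa),
   so x_n decays geometrically with constants depending on T only.  This also
   holds below the cutoff for invariant states of truncations of T, which exist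
   by averaging; the decay makes them uniformly tight, so that their limit along
   an ultrafilter is a normal invariant state of T. *)
Require Import Defs.
From HB Require Import structures.
From mathcomp Require Import all_boot all_order all_algebra.
From mathcomp Require Import complex.
From mathcomp Require Import all_classical all_reals all_analysis.
From mathcomp Require Import ring lra.

Set Implicit Arguments.
Unset Strict Implicit.
Unset Printing Implicit Defensive.

Import Order.TTheory GRing.Theory Num.Theory.
Import numFieldNormedType.Exports.

Local Open Scope classical_set_scope.
Local Open Scope complex_scope.
Local Open Scope ring_scope.

(** The threshold of part 1 is where the cut inequality becomes a contraction. For
    [rho = lam_n x_n / (mu_{n+1} x_{n+1})] below 1 it reads [(1 - rho)^2 / rho <= 4 |eta_n|^2 /
    (lam_n mu_{n+1})]. The left side decreases in [rho] on (0, 1), so [rho >= q] once the right side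
    is at most [(1 - q)^2 / q]. Detailed balance then bounds [x_n] by a multiple of [pi_n / q^n]. In
    part 2 the constant 1 comes from the inequality of arithmetic and geometric means for [a_n x_n]
    and [a_{n+1} x_{n+1}], with [a_n = lam_n - mu_n].

    The obstacle is normality. States have pointwise limits along ultrafilters, but mass may escape
    to infinity, and normality is phrased by suprema of directed families in the operator order. The
    bridge is that diagonal entries of [S - A] become small along a directed family with supremum
    [S]. It serves twice: tight states are normal, and the diagonal of [T (p_ m)] is 1 below [m],
    which makes the cut inequality available. *)

Arguments ell2_val : simpl never.
Arguments bop_val : simpl never.
Arguments inner : simpl never.
Arguments csum : simpl never.

(** * Complex numbers by components, their limits, and positive sesquilinear forms *)

Section ComplexLimits.
Variable R : realType.
Local Notation C := R[i].
Local Notation Re := (@complex.Re R).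
Local Notation Im := (@complex.Im R).

Lemma complex_ext (z w : C) : Re z = Re w -> Im z = Im w -> z = w.
Proof. by case: z w => a b [c d] /= -> ->. Qed.

Lemma cReD (z w : C) : Re (z + w) = Re z + Re w.
Proof. by case: z w => a b [c d]. Qed.

Lemma cImD (z w : C) : Im (z + w) = Im z + Im w.
Proof. by case: z w => a b [c d]. Qed.

Lemma cReN (z : C) : Re (- z) = - Re z.
Proof. by case: z. Qed.

Lemma cImN (z : C) : Im (- z) = - Im z.
Proof. by case: z. Qed.

Lemma cReM (z w : C) : Re (z * w) = Re z * Re w - Im z * Im w.
Proof. by case: z w => a b [c d]. Qed.

Lemma cImM (z w : C) : Im (z * w) = Re z * Im w + Im z * Re w.
Proof. by case: z w => a b [c d]. Qed.

Lemma cReJ (z : C) : Re z^* = Re z.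
Proof. by case: z. Qed.

Lemma cImJ (z : C) : Im z^* = - Im z.
Proof. by case: z. Qed.

Lemma cJD (z w : C) : (z + w)^* = z^* + w^*.
Proof. exact: rmorphD. Qed.

Lemma cJN (z : C) : (- z)^* = - z^*.
Proof. exact: rmorphN. Qed.

Lemma cJM (z w : C) : (z * w)^* = z^* * w^*.
Proof. exact: rmorphM. Qed.

Lemma cJ0 : (0 : C)^* = 0.
Proof. exact: rmorph0. Qed.

Lemma cJ1 : (1 : C)^* = 1.
Proof. exact: rmorph1. Qed.

Lemma cJK (z : C) : (z^*)^* = z.
Proof. by case: z => a b; apply: complex_ext; rewrite /= ?opprK. Qed.

Lemma cJ_sum I (r : seq I) (P : pred I) (F : I -> C) :
  (\sum_(i <- r | P i) F i)^* = \sum_(i <- r | P i) (F i)^*.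
Proof. exact: rmorph_sum. Qed.

Lemma cRe_sum I (r : seq I) (P : pred I) (F : I -> C) :
  Re (\sum_(i <- r | P i) F i) = \sum_(i <- r | P i) Re (F i).
Proof. by apply: big_morph => //; exact: cReD. Qed.

Lemma cIm_sum I (r : seq I) (P : pred I) (F : I -> C) :
  Im (\sum_(i <- r | P i) F i) = \sum_(i <- r | P i) Im (F i).
Proof. by apply: big_morph => //; exact: cImD. Qed.

Lemma conj_real (a : R) : (a%:C)^* = a%:C.
Proof. by apply: complex_ext; rewrite ?cReJ ?cImJ //= oppr0. Qed.

Lemma real_complexM (a b : R) : (a * b)%:C = a%:C * b%:C.
Proof. exact: rmorphM. Qed.

Lemma ge0_complexP (z : C) : (0 <= z) <-> (0 <= Re z /\ Im z = 0).
Proof.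
rewrite lecE /=; split=> [/andP[/eqP -> ->]//|[-> ->]].
by rewrite eqxx.
Qed.

Lemma mulJz (z : C) : z^* * z = (sqmod z)%:C.
Proof. by rewrite sqmodE; case: z => a b; apply: complex_ext => /=; ring. Qed.

Lemma sqmodJ (z : C) : sqmod z^* = sqmod z.
Proof. by rewrite !sqmodE cReJ cImJ sqrrN. Qed.

Lemma sqmodN (z : C) : sqmod (- z) = sqmod z.
Proof. by rewrite !sqmodE cReN cImN !sqrrN. Qed.

Lemma sqmod_eq0 (z : C) : sqmod z = 0 -> z = 0.
Proof.
rewrite sqmodE => /eqP; rewrite paddr_eq0 ?sqr_ge0// !sqrf_eq0.
by case: z => a b /= /andP[/eqP -> /eqP ->].
Qed.

Lemma sqmod_real (a : R) : sqmod a%:C = a ^+ 2.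
Proof. by rewrite sqmodE /= expr0n addr0. Qed.

Lemma normRe_le (z : C) (e : R) : 0 <= e -> sqmod z <= e ^+ 2 -> `|Re z| <= e.
Proof.
move=> e0 ze; rewrite -(@ler_pXn2r _ 2) ?nnegrE// real_normK ?num_real//.
by apply: le_trans ze; rewrite sqmodE lerDl sqr_ge0.
Qed.

Lemma normIm_le (z : C) (e : R) : 0 <= e -> sqmod z <= e ^+ 2 -> `|Im z| <= e.
Proof.
move=> e0 ze; rewrite -(@ler_pXn2r _ 2) ?nnegrE// real_normK ?num_real//.
by apply: le_trans ze; rewrite sqmodE lerDr sqr_ge0.
Qed.

(** Taken by components because [csum] is. The filter is arbitrary, since limits are used both along
    [\oo] and along ultrafilters. *)
Definition ccvg (I : Type) (F : set_system I) (u : I -> C) (l : C) : Prop :=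
  (fun i => Re (u i)) @ F --> Re l /\ (fun i => Im (u i)) @ F --> Im l.

Section Filter.
Variables (I : Type) (F : set_system I).
Context {FF : ProperFilter F}.

Lemma ccvg_cst (l : C) : ccvg F (fun=> l) l.
Proof. by split; exact: cvg_cst. Qed.

Lemma ccvgD u v l m : ccvg F u l -> ccvg F v m -> ccvg F (fun i => u i + v i) (l + m).
Proof.
move=> [u1 u2] [v1 v2]; split; rewrite ?cReD ?cImD.
  by under eq_fun do rewrite cReD; exact: cvgD.
by under eq_fun do rewrite cImD; exact: cvgD.
Qed.

Lemma ccvgM u v l m : ccvg F u l -> ccvg F v m -> ccvg F (fun i => u i * v i) (l * m).
Proof.
move=> [u1 u2] [v1 v2]; split; rewrite ?cReM ?cImM.
  by under eq_fun do rewrite cReM; apply: cvgB; exact: cvgM.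
by under eq_fun do rewrite cImM; apply: cvgD; exact: cvgM.
Qed.

Lemma ccvgN u l : ccvg F u l -> ccvg F (fun i => - u i) (- l).
Proof.
move=> [u1 u2]; split; rewrite ?cReN ?cImN.
  by under eq_fun do rewrite cReN; exact: cvgN.
by under eq_fun do rewrite cImN; exact: cvgN.
Qed.

Lemma ccvgJ u l : ccvg F u l -> ccvg F (fun i => (u i)^*) l^*.
Proof.
move=> [u1 u2]; split; rewrite ?cReJ ?cImJ.
  by under eq_fun do rewrite cReJ; exact: u1.
by under eq_fun do rewrite cImJ; exact: cvgN.
Qed.

Lemma ccvg_unique u l m : ccvg F u l -> ccvg F u m -> l = m.
Proof.
move=> [u1 u2] [v1 v2]; apply: complex_ext.
  exact: (cvg_unique _ u1 v1).
exact: (cvg_unique _ u2 v2).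
Qed.

Lemma ccvg_ge0 u l : ccvg F u l -> (\forall i \near F, 0 <= u i) -> 0 <= l.
Proof.
move=> [u1 u2] u0; apply/ge0_complexP; split.
  rewrite -(cvg_lim _ u1)//; apply: limr_ge; first by apply/cvg_ex; exists (Re l).
  by apply: filterS u0 => i /ge0_complexP[].
have : (fun i => Im (u i)) @ F --> (0 : R).
  apply: (@cvg_trans _ ((fun=> 0 : R) @ F)); last exact: cvg_cst.
  by apply: near_eq_cvg; apply: filterS u0 => i /ge0_complexP[].
by move=> h; exact: (cvg_unique _ u2 h).
Qed.

Lemma ccvg_sqmod u l : ccvg F u l -> (fun i => sqmod (u i)) @ F --> sqmod l.
Proof.
move=> [u1 u2]; under eq_fun do rewrite sqmodE; rewrite sqmodE.
by apply: cvgD; rewrite expr2; under eq_fun do rewrite expr2; exact: cvgM.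
Qed.

Lemma ccvg_sqmod_le u l (M : R) :
  ccvg F u l -> (\forall i \near F, sqmod (u i) <= M) -> sqmod l <= M.
Proof.
move=> /ccvg_sqmod ul uM; rewrite -(cvg_lim _ ul)//.
by apply: limr_le => //; apply/cvg_ex; exists (sqmod l).
Qed.

Lemma ccvg0P u : (fun i => sqmod (u i)) @ F --> (0 : R) -> ccvg F u 0.
Proof.
move=> /cvgrPdist_lt u0; split; apply/cvgrPdist_le => e e0.
  have := u0 (e ^+ 2) (exprn_gt0 _ e0); apply: filterS => i.
  rewrite !sub0r !normrN ger0_norm ?sqmod_ge0// => /ltW; exact: normRe_le (ltW e0).
have := u0 (e ^+ 2) (exprn_gt0 _ e0); apply: filterS => i.
rewrite !sub0r !normrN ger0_norm ?sqmod_ge0// => /ltW; exact: normIm_le (ltW e0).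
Qed.

End Filter.

(* The form is only assumed positive; that it is hermitian is a consequence. *)
Section PositiveForm.
Variables (V : lmodType C) (B : V -> V -> C).
Hypothesis Br : forall x a y z, B x (a *: y + z) = a * B x y + B x z.
Hypothesis Bl : forall x y a z, B (a *: x + y) z = a^* * B x z + B y z.
Hypothesis B0 : forall x, 0 <= B x x.

Lemma posform_expand a x y : B (a *: x + y) (a *: x + y) =
  (sqmod a)%:C * B x x + a^* * B x y + a * B y x + B y y.
Proof. by rewrite Br !Bl -mulJz; ring. Qed.

(** Polarization: reality of the form at [x + y] gives the imaginary part of the identity, reality
    at [i x + y] the real part. *)
Lemma posform_herm x y : B y x = (B x y)^*.
Proof.
have [[_ xx] [_ yy]] := ((ge0_complexP _).1 (B0 x), (ge0_complexP _).1 (B0 y)).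
have [_] := (ge0_complexP _).1 (B0 (1 *: x + y)).
have [_] := (ge0_complexP _).1 (B0 ((0 +i* 1) *: x + y)).
rewrite !posform_expand !cImD !cImM !cReJ !cImJ xx yy /=.
case: (B x y) (B y x) => a b [c d] /= h1 h2.
by apply: complex_ext => /=; lra.
Qed.

Lemma posform_cauchy x y : sqmod (B x y) <= Re (B x x) * Re (B y y).
Proof.
have [[p0 px] [r0 rx]] := ((ge0_complexP _).1 (B0 x), (ge0_complexP _).1 (B0 y)).
set c := B x y; set p := Re (B x x) in p0 *; set r := Re (B y y) in r0 *.
(* The form at [- s c x + y] is a quadratic in [s], minimal at [s = 1 / p] when [p] and [c] are
   nonzero; this value gives the claim. *)
have h (s : R) : 0 <= s ^+ 2 * sqmod c * p - 2 * s * sqmod c + r.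
  have [] := (ge0_complexP _).1 (B0 ((- s%:C * c) *: x + y)).
  rewrite posform_expand (posform_herm x y) -/c !(cReD,cReM,cImM,cReJ,cImJ,cReN,cImN) -/p -/r px /= => + _.
  rewrite sqmodM sqmodN sqmod_real [X in 2 * s * X]sqmodE => h.
  by apply: le_trans h _; rewrite le_eqVlt; apply/orP; left; apply/eqP; ring.
have := sqmod_ge0 c; rewrite le_eqVlt => /predU1P[<-|m0]; first exact: mulr_ge0.
move: p0; rewrite le_eqVlt => /predU1P[p0|p0].
  (* For [p = 0] the quadratic degenerates to an affine function, which takes the value -1 at this
     [s]. *)
  have := h ((r + 1) / (2 * sqmod c)); rewrite -p0 mulr0 mul0r add0r.
  have -> : 2 * ((r + 1) / (2 * sqmod c)) * sqmod c = r + 1.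
    by field; rewrite gt_eqF.
  by move=> ?; exfalso; lra.
have := h p^-1; have -> : p^-1 ^+ 2 * sqmod c * p - 2 * p^-1 * sqmod c + r =
  p^-1 * (p * r - sqmod c) by field; rewrite gt_eqF.
by rewrite pmulr_rge0 ?invr_gt0// subr_ge0.
Qed.

End PositiveForm.

End ComplexLimits.

(** * The inner product of [ell2], truncation of vectors, and Riesz representation *)

Section Hilbert.
Variable R : realType.
Local Notation C := R[i].
Local Notation H := (ell2 R).
Local Notation Re := (@complex.Re R).
Local Notation Im := (@complex.Im R).
Local Notation e_ := (ebasis R).

Lemma csum_cvg (u : nat -> C) :
  cvgn (series (fun k => Re (u k))) -> cvgn (series (fun k => Im (u k))) ->
  ccvg \oo (fun n => \sum_(0 <= k < n) u k) (csum u).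
Proof.
move=> ru iu; split.
  by under eq_fun do rewrite cRe_sum; exact: ru.
by under eq_fun do rewrite cIm_sum; exact: iu.
Qed.

Lemma abs_dominated_cvg (f : nat -> R) (x y : H) :
  (forall k, `|f k| <= sqmod (x k) + sqmod (y k)) -> cvgn (series f).
Proof.
move=> fxy; apply: normed_cvg; apply: (series_le_cvg _ _ fxy) => //.
  by move=> k; rewrite addr_ge0 ?sqmod_ge0.
by apply: is_cvg_seriesD; exact: ell2_cvg.
Qed.

Lemma norm_mul_le (z w : C) : `|Re (z^* * w)| <= sqmod z + sqmod w /\
  `|Im (z^* * w)| <= sqmod z + sqmod w.
Proof.
case: z w => a b [c d]; rewrite !sqmodE cReM cImM cReJ cImJ /=.
have [p q] := (sqr_ge0 (a + c), sqr_ge0 (b + d)).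
have [p' q'] := (sqr_ge0 (a - c), sqr_ge0 (b - d)).
have [r s] := (sqr_ge0 (a + d), sqr_ge0 (b + c)).
have [r' s'] := (sqr_ge0 (a - d), sqr_ge0 (b - c)).
by split; rewrite ler_norml; apply/andP; split; nra.
Qed.

Lemma inner_cvg (x y : H) :
  ccvg \oo (fun n => \sum_(0 <= k < n) (x k)^* * y k) (inner x y).
Proof.
by apply: csum_cvg; apply: (@abs_dominated_cvg _ x y) => k;
  have [] := norm_mul_le (x k) (y k).
Qed.

Lemma ell2D (x y : H) k : (x + y) k = x k + y k.
Proof. by []. Qed.

Lemma ell2Z a (x : H) k : (a *: x) k = a * x k.
Proof. by []. Qed.

Lemma ell2N (x : H) k : (- x) k = - x k.
Proof. by []. Qed.

Lemma ell2_sum I (r : seq I) (P : pred I) (F : I -> H) k :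
  (\sum_(i <- r | P i) F i) k = \sum_(i <- r | P i) F i k.
Proof. by apply: (big_morph (fun x : H => x k)). Qed.

Lemma ell2_ext (x y : H) : (forall k, x k = y k) -> x = y.
Proof. by move=> xy; apply: val_inj; exact/funext. Qed.

Lemma inner_linear (x y z : H) a : inner x (a *: y + z) = a * inner x y + inner x z.
Proof.
apply: (ccvg_unique (inner_cvg _ _)).
rewrite [X in ccvg _ X](_ : _ = (fun n => a * (\sum_(0 <= k < n) (x k)^* * y k) +
  \sum_(0 <= k < n) (x k)^* * z k)).
  apply: ccvgD; last exact: inner_cvg.
  by apply: ccvgM; [exact: ccvg_cst|exact: inner_cvg].
apply/funext => n; rewrite mulr_sumr -big_split/=.
by apply: eq_bigr => k _; rewrite mulrDr mulrCA.
Qed.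

Lemma innerJ (x y : H) : (inner x y)^* = inner y x.
Proof.
apply: (ccvg_unique (ccvgJ (inner_cvg x y))).
rewrite [X in ccvg _ X](_ : _ = (fun n => \sum_(0 <= k < n) (y k)^* * x k)).
  exact: inner_cvg.
apply/funext => n; rewrite cJ_sum.
by apply: eq_bigr => k _; rewrite cJM cJK mulrC.
Qed.

Lemma innerDr (x y z : H) : inner x (y + z) = inner x y + inner x z.
Proof. by rewrite -[y]scale1r inner_linear mul1r scale1r. Qed.

Lemma inner0r (x : H) : inner x 0 = 0.
Proof. by apply: (addIr (inner x 0)); rewrite -innerDr !add0r. Qed.

Lemma innerZr (x y : H) a : inner x (a *: y) = a * inner x y.
Proof. by rewrite -[a *: y]addr0 inner_linear inner0r addr0. Qed.

Lemma innerNr (x y : H) : inner x (- y) = - inner x y.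
Proof. by rewrite -scaleN1r innerZr mulN1r. Qed.

Lemma innerDl (x y z : H) : inner (x + y) z = inner x z + inner y z.
Proof. by rewrite -innerJ innerDr cJD !innerJ. Qed.

Lemma innerZl (x y : H) a : inner (a *: x) y = a^* * inner x y.
Proof. by rewrite -innerJ innerZr cJM innerJ. Qed.

Lemma innerNl (x y : H) : inner (- x) y = - inner x y.
Proof. by rewrite -innerJ innerNr cJN innerJ. Qed.

Lemma inner0l (x : H) : inner 0 x = 0.
Proof. by rewrite -innerJ inner0r cJ0. Qed.

Lemma inner_sumr (x : H) I (r : seq I) (P : pred I) (F : I -> H) :
  inner x (\sum_(i <- r | P i) F i) = \sum_(i <- r | P i) inner x (F i).
Proof. by apply: big_morph; [exact: innerDr|exact: inner0r]. Qed.

Lemma inner_suml (x : H) I (r : seq I) (P : pred I) (F : I -> H) :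
  inner (\sum_(i <- r | P i) F i) x = \sum_(i <- r | P i) inner (F i) x.
Proof.
by apply: (big_morph (fun y => inner y x)) => [y z|]; rewrite ?innerDl ?inner0l.
Qed.

Lemma inner_norm (x : H) : inner x x = (hnorm x ^+ 2)%:C.
Proof.
rewrite sqr_hnorm /inner /csum.
have -> : (fun k => Re ((x k)^* * x k)) = (fun k => sqmod (x k)).
  by apply/funext => k; rewrite mulJz.
have -> : (fun k => Im ((x k)^* * x k)) = (fun k => 0).
  by apply/funext => k; rewrite mulJz.
rewrite [X in _ +i* limn X](_ : _ = cst 0) ?lim_cst//.
by apply/funext => n; rewrite /series/= big1.
Qed.

Lemma inner_ge0 (x : H) : 0 <= inner x x.
Proof. by rewrite inner_norm ler0c sqr_ge0. Qed.

Lemma inner_cauchy (x y : H) : sqmod (inner x y) <= hnorm x ^+ 2 * hnorm y ^+ 2.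
Proof.
have -> : hnorm x ^+ 2 * hnorm y ^+ 2 = Re (inner x x) * Re (inner y y).
  by rewrite !inner_norm.
apply: (@posform_cauchy R H (@inner R)) => [u a v w|u v a w|u].
- exact: inner_linear.
- by rewrite innerDl innerZl.
- exact: inner_ge0.
Qed.

Lemma hnorm_eq0 (x : H) : hnorm x ^+ 2 = 0 -> x = 0.
Proof.
move=> x0; apply: ell2_ext => k; apply: sqmod_eq0.
by apply/eqP; rewrite eq_le sqmod_ge0 andbT -x0 sqmod_le_hnorm.
Qed.

Lemma inner_ext (x y : H) : (forall z, inner x z = inner y z) -> x = y.
Proof.
move=> xy; apply/eqP; rewrite -subr_eq0; apply/eqP/hnorm_eq0/complexI.
by rewrite -inner_norm innerDl innerNl xy subrr.
Qed.

Lemma ebasisE n k : e_ n k = (k == n)%:R.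
Proof. by []. Qed.

Lemma inner_ebasis n (x : H) : inner (e_ n) x = x n.
Proof.
apply: (ccvg_unique (inner_cvg _ _)).
have E N : (n < N)%N -> \sum_(0 <= k < N) (e_ n k)^* * x k = x n.
  move=> nN; rewrite (bigD1_seq n) ?mem_index_iota ?iota_uniq//.
  rewrite ebasisE eqxx big1; first by rewrite cJ1 mul1r; exact: addr0.
  move=> k kn.
  by rewrite ebasisE (negPf kn) cJ0 mul0r.
by split; apply: cvg_near_cst; exists n.+1 => // N /E ->.
Qed.

Lemma inner_ebasisr n (x : H) : inner x (e_ n) = (x n)^*.
Proof. by rewrite -innerJ inner_ebasis. Qed.

Lemma hnorm_ebasis n : hnorm (e_ n) ^+ 2 = 1.
Proof. by apply: complexI; rewrite -inner_norm inner_ebasis ebasisE eqxx. Qed.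

Definition trunc K (x : H) : H := \sum_(0 <= k < K) x k *: e_ k.

Lemma inner_trunc K (x y : H) :
  inner (trunc K x) y = \sum_(0 <= k < K) (x k)^* * y k.
Proof.
by rewrite inner_suml; apply: eq_bigr => k _; rewrite innerZl inner_ebasis.
Qed.

Lemma truncE K (x : H) j : trunc K x j = if (j < K)%N then x j else 0.
Proof.
rewrite ell2_sum; case: ltnP => jK.
  rewrite (bigD1_seq j) ?mem_index_iota ?iota_uniq//= ell2Z ebasisE eqxx mulr1.
  by rewrite big1 ?addr0// => k kj; rewrite ell2Z ebasisE eq_sym (negPf kj) mulr0.
rewrite big_nat_cond big1// => k; rewrite andbT => /andP[_ kK].
by rewrite ell2Z ebasisE gtn_eqF ?mulr0// (leq_trans kK).
Qed.

Lemma trunc_sqmod K (x : H) : hnorm (trunc K x) ^+ 2 = \sum_(0 <= k < K) sqmod (x k).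
Proof.
apply: complexI; rewrite -inner_norm inner_trunc rmorph_sum/=.
rewrite !big_nat; apply: eq_bigr => k /andP[_ kK].
by rewrite truncE kK mulJz.
Qed.

Lemma hnormB_trunc K (x : H) :
  hnorm (x - trunc K x) ^+ 2 = hnorm x ^+ 2 - \sum_(0 <= k < K) sqmod (x k).
Proof.
apply: complexI; rewrite -inner_norm innerDl innerNl !innerDr !innerNr.
rewrite rmorphB/= -inner_norm -[inner x (trunc K x)]innerJ -trunc_sqmod.
rewrite -(inner_norm (trunc K x)).
have -> : inner (trunc K x) x = inner (trunc K x) (trunc K x).
  rewrite !inner_trunc !big_nat; apply: eq_bigr => k /andP[_ kK].
  by rewrite truncE kK.
rewrite innerJ; ring.
Qed.

Lemma trunc_cvg (x : H) : (fun K => hnorm (x - trunc K x) ^+ 2) @ \oo --> (0 : R).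
Proof.
have : (fun K => hnorm x ^+ 2 - series (fun k => sqmod (x k)) K) @ \oo -->
    hnorm x ^+ 2 - hnorm x ^+ 2.
  by apply: cvgB; [exact: cvg_cst|rewrite sqr_hnorm; exact: ell2_cvg].
rewrite subrr; apply: cvg_trans; apply: near_eq_cvg; apply: nearW => K.
by rewrite hnormB_trunc.
Qed.

Lemma cvg_squeeze0 (f g : nat -> R) : (forall n, 0 <= f n <= g n) ->
  g @ \oo --> (0 : R) -> f @ \oo --> (0 : R).
Proof.
move=> fg g0; apply: (squeeze_cvgr _ (cvg_cst 0) g0).
by apply: nearW.
Qed.

(** The representing vector has the coordinates [(g (e_ k))^*]. The norm bound makes the adjoint a
    bounded operator. *)
Lemma riesz_bound (g : H -> C) (M : R) :
  (forall a x y, g (a *: x + y) = a * g x + g y) ->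
  (forall x, sqmod (g x) <= M * hnorm x ^+ 2) ->
  exists2 u : H, (forall x, g x = inner u x) & hnorm u ^+ 2 <= M.
Proof.
move=> gl gM.
have g0 : g 0 = 0.
  by apply: (addIr (g 0)); rewrite add0r -{1}[g 0]mul1r -gl scaler0 addr0.
have gD x y : g (x + y) = g x + g y by rewrite -[x]scale1r gl mul1r scale1r.
have gZ a x : g (a *: x) = a * g x by rewrite -[a *: x]addr0 gl g0 addr0.
have gsum (r : seq nat) (F : nat -> H) : g (\sum_(i <- r) F i) = \sum_(i <- r) g (F i).
  exact: (big_morph g).
pose S K : R := \sum_(0 <= k < K) sqmod (g (e_ k)).
have S0 K : 0 <= S K by apply: sumr_ge0 => k _; exact: sqmod_ge0.
have SM K : S K <= M.
  (* Both [g w] and [hnorm w ^+ 2] equal [S K], so [gM] at [w] reads [S K ^+ 2 <= M * S K]. *)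
  pose w : H := \sum_(0 <= k < K) (g (e_ k))^* *: e_ k.
  have wk k : (k < K)%N -> w k = (g (e_ k))^*.
    move=> kK; rewrite ell2_sum (bigD1_seq k) ?mem_index_iota ?iota_uniq//=.
    rewrite ell2Z ebasisE eqxx mulr1 big1 ?addr0// => j jk.
    by rewrite ell2Z ebasisE eq_sym (negPf jk) mulr0.
  have gw : g w = (S K)%:C.
    rewrite gsum rmorph_sum/=; apply: eq_bigr => k _.
    by rewrite gZ mulJz.
  have nw : hnorm w ^+ 2 = S K.
    apply: complexI; rewrite -inner_norm {1}/w inner_suml rmorph_sum/= !big_nat.
    apply: eq_bigr => k /andP[_ kK]; rewrite innerZl inner_ebasis wk// cJK.
    by rewrite mulrC mulJz.
  have := gM w; rewrite gw nw sqmod_real expr2.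
  have := S0 K; rewrite le_eqVlt => /predU1P[<- _|K0]; last by rewrite ler_pM2r.
  (* If [S K = 0], only [0 <= M] remains, and any unit vector shows it. *)
  have := gM (e_ 0%N); rewrite hnorm_ebasis mulr1; apply: le_trans; exact: sqmod_ge0.
have usum : (fun k => (g (e_ k))^*) \in @sqsummable R.
  apply/asboolP; apply: nondecreasing_is_cvgn.
    by apply: nondecreasing_series => k _ _; exact: sqmod_ge0.
  exists M => _ [K _ <-]; rewrite /series/=.
  by under eq_bigr do rewrite sqmodJ; exact: SM.
pose u : H := Ell2 usum.
exists u => [x|]; last first.
  rewrite sqr_hnorm; apply: limr_le; first exact: ell2_cvg.
  apply: nearW => K; rewrite /series/=.
  by under eq_bigr do rewrite sqmodJ; exact: SM.
apply: (ccvg_unique _ (inner_cvg u x)).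
have -> : (fun n => \sum_(0 <= k < n) (u k)^* * x k) =
          (fun n => g x + - g (x - trunc n x)).
  apply/funext => n; rewrite -[- g _]mulN1r -gZ -gD scaleN1r opprB addrC subrK.
  by rewrite gsum; apply: eq_bigr => k _; rewrite gZ cJK mulrC.
rewrite -[X in ccvg _ _ X]addr0 -[X in _ + X]oppr0.
apply: ccvgD; first exact: ccvg_cst.
apply/ccvgN/ccvg0P; apply: (@cvg_squeeze0 _ (fun n => M * hnorm (x - trunc n x) ^+ 2)).
  by move=> n; rewrite sqmod_ge0 gM.
by rewrite -(mulr0 M); apply: cvgM; [exact: cvg_cst|exact: trunc_cvg].
Qed.

End Hilbert.

(** * Adjoints, the operator order, interval projections and matrix entries *)

Section Operators.
Variable R : realType.
Local Notation C := R[i].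
Local Notation H := (ell2 R).
Local Notation Re := (@complex.Re R).
Local Notation Im := (@complex.Im R).
Local Notation e_ := (ebasis R).
Local Notation bop := (bop R).
Local Notation idop := (idop R).

Lemma bopD (A B : bop) x : (A + B) x = A x + B x.
Proof. by []. Qed.

Lemma bopN (A : bop) x : (- A) x = - A x.
Proof. by []. Qed.

Lemma bopB (A B : bop) x : (A - B) x = A x - B x.
Proof. by []. Qed.

Lemma bopZ a (A : bop) x : (a *: A) x = a *: A x.
Proof. by []. Qed.

Lemma bop0 x : (0 : bop) x = 0.
Proof. by []. Qed.

Lemma bop_sum I (r : seq I) (P : pred I) (F : I -> bop) x :
  (\sum_(i <- r | P i) F i) x = \sum_(i <- r | P i) F i x.
Proof. by apply: (big_morph (fun A : bop => A x)). Qed.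

Lemma idopE (x : H) : idop x = x.
Proof. by []. Qed.

Lemma compopE (A B : bop) x : compop A B x = A (B x).
Proof. by []. Qed.

Lemma mxunitE n m (x : H) : mxunit R n m x = x m *: e_ n.
Proof. by []. Qed.

Lemma bop_ext_fun (A B : bop) : (forall x, A x = B x) -> A = B.
Proof. by move=> AB; apply: val_inj; exact/funext. Qed.

(** [K] bounds the square of the operator norm, hence [compop (adj A) A] in the operator order; no
    square roots appear in the state estimates. *)
Definition sqbounded (K : R) (A : bop) : Prop :=
  0 <= K /\ forall x, hnorm (A x) ^+ 2 <= K * hnorm x ^+ 2.

Lemma bop_sqbounded (A : bop) : exists K, sqbounded K A.
Proof.
have [M AM] := bop_bounded A; exists (M ^+ 2); split=> [|x]; first exact: sqr_ge0.
rewrite -exprMn (@ler_pXn2r R 2) ?nnegrE ?hnorm_ge0//.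
exact: le_trans (hnorm_ge0 _) (AM x).
Qed.

(** The difference kills every [trunc n x], and [x - trunc n x] tends to 0 in norm. *)
Lemma bop_ext (A B : bop) : (forall n, A (e_ n) = B (e_ n)) -> A = B.
Proof.
move=> AB; apply: bop_ext_fun => x.
have [K [K0 DK]] := bop_sqbounded (A - B).
suff: hnorm ((A - B) x) ^+ 2 = 0 by move/hnorm_eq0/eqP; rewrite bopB subr_eq0 => /eqP.
have Dt n : (A - B) (x - trunc n x) = (A - B) x.
  rewrite [LHS]linearB/= linear_sum/= big1 ?subr0// => k _.
  by rewrite linearZ/= bopB AB subrr scaler0.
apply: (cvg_unique _ (F := (fun=> hnorm ((A - B) x) ^+ 2) @ \oo)) => //.
  exact: cvg_cst.
apply: (@cvg_squeeze0 _ _ (fun n => K * hnorm (x - trunc n x) ^+ 2)).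
  by move=> n; rewrite sqr_ge0/= -(Dt n) DK.
by rewrite -(mulr0 K); apply: cvgM; [exact: cvg_cst|exact: trunc_cvg].
Qed.

Lemma adjoint_ex (A : bop) : exists B : bop, forall x y, inner (B x) y = inner x (A y).
Proof.
have [K [K0 AK]] := bop_sqbounded A.
have /choice[B BP] (x : H) : exists u : H,
    (forall y, inner x (A y) = inner u y) /\ hnorm u ^+ 2 <= hnorm x ^+ 2 * K.
  have [|y|u uA uK] := @riesz_bound R (fun y => inner x (A y)) (hnorm x ^+ 2 * K).
  - by move=> a y z; rewrite linearP inner_linear.
  - apply: le_trans (inner_cauchy _ _) _.
    by rewrite -mulrA ler_wpM2l ?sqr_ge0.
  - by exists u.
have Bb : B \in @bounded_linear R.
  apply/asboolP; split.
    move=> a x y; apply: inner_ext => z.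
    by rewrite innerDl innerZl -!(BP _).1 innerDl innerZl.
  exists (Num.sqrt K) => x.
  rewrite -(@ler_pXn2r R 2) ?nnegrE ?mulr_ge0 ?hnorm_ge0 ?sqrtr_ge0//.
  by rewrite exprMn (sqr_sqrtr K0) mulrC; exact: (BP x).2.
by exists (Bop Bb) => x y; rewrite -(BP x).1.
Qed.

Definition adj (A : bop) : bop := projT1 (cid (adjoint_ex A)).

Lemma adjP (A : bop) x y : inner (adj A x) y = inner x (A y).
Proof. exact: (projT2 (cid (adjoint_ex A))). Qed.

Lemma adjPr (A : bop) x y : inner x (adj A y) = inner (A x) y.
Proof. by rewrite -innerJ adjP innerJ. Qed.

Lemma adj_unique (A B : bop) :
  (forall x y, inner (B x) y = inner x (A y)) -> adj A = B.
Proof.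
by move=> AB; apply: bop_ext_fun => x; apply: inner_ext => y; rewrite adjP AB.
Qed.

Lemma adjK (A : bop) : adj (adj A) = A.
Proof. by apply: adj_unique => x y; rewrite adjPr. Qed.

Lemma adj_id : adj idop = idop.
Proof. exact: adj_unique. Qed.

Lemma adj_conjlinear a (A B : bop) : adj (a *: A + B) = a^* *: adj A + adj B.
Proof.
apply: adj_unique => x y.
by rewrite !bopD !bopZ innerDl innerDr innerZl innerZr cJK !adjP.
Qed.

Lemma compop_linear (D : bop) a (A B : bop) :
  compop D (a *: A + B) = a *: compop D A + compop D B.
Proof.
by apply: bop_ext_fun => x; rewrite bopD bopZ !compopE bopD bopZ linearP.
Qed.

Lemma compop_semilinear (D : bop) a (A B : bop) :
  compop (a *: A + B) D = a *: compop A D + compop B D.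
Proof. by apply: bop_ext_fun => x; rewrite bopD bopZ !compopE bopD bopZ. Qed.

Lemma sqbounded_adj K (A : bop) : sqbounded K A -> sqbounded K (adj A).
Proof.
move=> [K0 AK]; split=> // y; set v := adj A y.
have [->|v0] := eqVneq (hnorm v ^+ 2) 0; first by rewrite mulr_ge0 ?sqr_ge0.
have vp : 0 < hnorm v ^+ 2 by rewrite lt_neqAle eq_sym v0 sqr_ge0.
suff: sqmod (inner v v) <= K * hnorm y ^+ 2 * hnorm v ^+ 2.
  by rewrite inner_norm sqmod_real [X in X <= _]expr2 ler_pM2r.
rewrite {1}/v adjP; apply: le_trans (inner_cauchy _ _) _.
have -> : K * hnorm y ^+ 2 * hnorm v ^+ 2 = hnorm y ^+ 2 * (K * hnorm v ^+ 2) by ring.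
by apply: ler_wpM2l; [exact: sqr_ge0|exact: AK].
Qed.

Lemma sqbounded_comp K L (A B : bop) :
  sqbounded K A -> sqbounded L B -> sqbounded (K * L) (compop A B).
Proof.
move=> [K0 AK] [L0 BL]; split=> [|x]; first exact: mulr_ge0.
by apply: le_trans (AK _) _; rewrite -mulrA ler_wpM2l.
Qed.

Lemma op_pos_adj (A : bop) : op_pos (compop (adj A) A).
Proof. by move=> x; rewrite compopE adjPr inner_ge0. Qed.

Lemma op_posD (A B : bop) : op_pos A -> op_pos B -> op_pos (A + B).
Proof. by move=> a b x; rewrite bopD innerDr addr_ge0. Qed.

Lemma op_posZ a (A : bop) : 0 <= a -> op_pos A -> op_pos (a *: A).
Proof. by move=> a0 A0 x; rewrite bopZ innerZr mulr_ge0. Qed.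

Lemma op_pos0 : op_pos (0 : bop).
Proof. by move=> x; rewrite bop0 inner0r. Qed.

Lemma op_pos_sum I (r : seq I) (P : pred I) (F : I -> bop) :
  (forall i, P i -> op_pos (F i)) -> op_pos (\sum_(i <- r | P i) F i).
Proof.
move=> F0; apply: big_ind => //; [exact: op_pos0|by move=> A B; exact: op_posD].
Qed.

Lemma op_le_refl (A : bop) : op_le A A.
Proof. by rewrite /op_le subrr; exact: op_pos0. Qed.

Lemma op_le_trans (A B D : bop) : op_le A B -> op_le B D -> op_le A D.
Proof.
by move=> a b; rewrite /op_le -(subrK B D) -addrA; exact: op_posD.
Qed.

Lemma op_leP (A B : bop) : op_le A B <-> forall x, inner x (A x) <= inner x (B x).
Proof.
split=> AB x; have := AB x; first by rewrite bopB innerDr innerNr subr_ge0.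
by rewrite bopB innerDr innerNr subr_ge0.
Qed.

Lemma sqbounded_le K (A : bop) :
  sqbounded K A -> op_le (compop (adj A) A) (K%:C *: idop).
Proof.
move=> [K0 AK]; apply/op_leP => x.
rewrite compopE adjPr bopZ innerZr !inner_norm -rmorphM lecR; exact: AK.
Qed.

Lemma op_pos_herm (A : bop) x y : op_pos A -> inner y (A x) = (inner x (A y))^*.
Proof.
move=> A0; apply: (@posform_herm R H (fun x y => inner x (A y))) => //.
  by move=> u a v w; rewrite linearP inner_linear.
by move=> u v a w; rewrite innerDl innerZl.
Qed.

Lemma op_pos_cauchy (A : bop) x y : op_pos A ->
  sqmod (inner x (A y)) <= Re (inner x (A x)) * Re (inner y (A y)).
Proof.
move=> A0; apply: (@posform_cauchy R H (fun x y => inner x (A y))) => //.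
  by move=> u a v w; rewrite linearP inner_linear.
by move=> u v a w; rewrite innerDl innerZl.
Qed.

Lemma op_pos_entry_herm (A : bop) i j : op_pos A -> A (e_ i) j = (A (e_ j) i)^*.
Proof. by move=> A0; rewrite -!inner_ebasis; exact: op_pos_herm. Qed.

(** Cauchy-Schwarz bounds the squared modulus of an entry by the product of two diagonal entries.
    The structure of [T (p_ n)] is read off its diagonal in this way. *)
Lemma op_pos_diag0 (A : bop) i : op_pos A -> A (e_ i) i = 0 -> A (e_ i) = 0.
Proof.
move=> A0 Aii; apply: ell2_ext => k; apply: sqmod_eq0; apply/eqP.
rewrite eq_le sqmod_ge0 andbT -(inner_ebasis k).
apply: le_trans (op_pos_cauchy _ _ A0) _.
by rewrite !inner_ebasis Aii mulr0.
Qed.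

(* ||A v||^4 <= <Av, A (Av)> <v, A v> by the Cauchy-Schwarz inequality of A. *)
Lemma op_pos_sq_le (A : bop) v K : op_pos A -> 0 <= K ->
  (forall x, Re (inner x (A x)) <= K * hnorm x ^+ 2) ->
  hnorm (A v) ^+ 2 <= K * Re (inner v (A v)).
Proof.
move=> A0 K0 AK; have [v0 _] := (ge0_complexP _).1 (A0 v).
have [->|w0] := eqVneq (hnorm (A v) ^+ 2) 0; first by rewrite mulr_ge0.
have wp : 0 < hnorm (A v) ^+ 2 by rewrite lt_neqAle eq_sym w0 sqr_ge0.
suff: sqmod (inner (A v) (A v)) <= K * Re (inner v (A v)) * hnorm (A v) ^+ 2.
  by rewrite inner_norm sqmod_real [X in X <= _]expr2 ler_pM2r.
apply: le_trans (op_pos_cauchy _ _ A0) _.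
set r := Re (inner v (A v)) in v0 *; have -> : K * r * hnorm (A v) ^+ 2 = K * hnorm (A v) ^+ 2 * r by ring.
by apply: ler_wpM2r => //; exact: AK.
Qed.

Lemma interval_projE n m (x : H) k :
  interval_proj R n m x k = if (n <= k <= m)%N then x k else 0.
Proof.
rewrite /interval_proj bop_sum ell2_sum.
case: ifPn => [nkm|].
  rewrite (bigD1_seq k) ?mem_index_iota ?iota_uniq//= mxunitE ell2Z ebasisE eqxx mulr1.
  by rewrite big1 ?addr0// => j jk; rewrite mxunitE ell2Z ebasisE eq_sym (negPf jk) mulr0.
move=> nkm; rewrite big_nat_cond big1// => j; rewrite andbT => /andP[nj jm].
rewrite mxunitE ell2Z ebasisE; case: eqP => [kj|]; last by rewrite mulr0.
by rewrite kj nj -ltnS jm in nkm.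
Qed.

Lemma interval_proj_idem n m :
  compop (interval_proj R n m) (interval_proj R n m) = interval_proj R n m.
Proof.
apply: bop_ext_fun => x; apply: ell2_ext => k; rewrite compopE !interval_projE.
by case: (n <= k <= m)%N.
Qed.

Lemma op_pos_mxunit n : op_pos (mxunit R n n).
Proof.
by move=> x; rewrite mxunitE innerZr inner_ebasisr mulrC mulJz ler0c sqmod_ge0.
Qed.

Lemma op_pos_interval n m : op_pos (interval_proj R n m).
Proof. by apply: op_pos_sum => k _; exact: op_pos_mxunit. Qed.

Lemma adj_interval n m : adj (interval_proj R n m) = interval_proj R n m.
Proof.
apply: adj_unique => x y.
by rewrite -[LHS]innerJ (op_pos_herm x y (op_pos_interval n m)) cJK.
Qed.

Lemma interval_le_id n m : op_le (interval_proj R n m) idop.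
Proof.
move=> x; set P := interval_proj R n m.
have -> : inner x ((idop - P) x) = inner (x - P x) (x - P x).
  rewrite bopB idopE innerDl innerNl -[inner (P x) _]adjPr adj_interval -/P.
  by rewrite linearB/= -compopE interval_proj_idem subrr inner0r subr0.
exact: inner_ge0.
Qed.

Lemma interval_projS n m : (n <= m.+1)%N ->
  interval_proj R n m.+1 = interval_proj R n m + mxunit R m.+1 m.+1.
Proof. by move=> nm; rewrite /interval_proj big_nat_recr. Qed.

(** Indices are exchanged: [rate_eta T n], a trace against [mxunit n.+1 n], is the entry in row [n]
    and column [n.+1]. *)
Lemma trace_mxunit n m (A : bop) : trace (compop (mxunit R n m) A) = A (e_ n) m.
Proof.
rewrite -[RHS]mulr1 -[X in _ * X](_ : inner (e_ n) (e_ n) = _); last first.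
  by rewrite inner_norm hnorm_ebasis.
rewrite -innerZr /trace /inner; congr csum; apply/funext => k.
rewrite -/(inner _ _) inner_ebasis compopE mxunitE !ell2Z ebasisE.
have [->|kn] := eqVneq k n; first by rewrite cJ1 mul1r.
by rewrite mulr0 cJ0 mul0r.
Qed.

Lemma cdiag_ge0 (A : bop) n : op_pos A -> 0 <= A (e_ n) n.
Proof. by move=> A0; rewrite -inner_ebasis. Qed.

End Operators.

(** * Not necessarily normal states: Cauchy-Schwarz and corner estimates *)

Section States.
Variable R : realType.
Local Notation C := R[i].
Local Notation H := (ell2 R).
Local Notation Re := (@complex.Re R).
Local Notation Im := (@complex.Im R).
Local Notation e_ := (ebasis R).
Local Notation bop := (bop R).
Local Notation idop := (idop R).

(** A predicate on bare functions, so that compositions with maps, averages and pointwise limits are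
    formed directly. *)
Definition linear_state (f : bop -> C) : Prop :=
  [/\ forall a x y, f (a *: x + y) = a * f x + f y, f idop = 1 &
      forall A, op_pos A -> 0 <= f A].

Lemma is_state_linear (phi : {scalar bop}) : is_state phi -> linear_state phi.
Proof. by move=> [phi1 phi0]; split=> // a x y; rewrite linearP. Qed.

Section OneState.
Variable f : bop -> C.
Hypothesis sf : linear_state f.

Lemma lstateP a x y : f (a *: x + y) = a * f x + f y.
Proof. by case: sf. Qed.

Lemma lstate1 : f idop = 1.
Proof. by case: sf. Qed.

Lemma lstate_ge0 A : op_pos A -> 0 <= f A.
Proof. by case: sf => _ _; apply. Qed.

Lemma lstateD x y : f (x + y) = f x + f y.
Proof. by rewrite -[x]scale1r lstateP mul1r scale1r. Qed.

Lemma lstate0 : f 0 = 0.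
Proof. by apply: (addIr (f 0)); rewrite -lstateD !add0r. Qed.

Lemma lstateZ a x : f (a *: x) = a * f x.
Proof. by rewrite -[a *: x]addr0 lstateP lstate0 addr0. Qed.

Lemma lstateN x : f (- x) = - f x.
Proof. by rewrite -scaleN1r lstateZ mulN1r. Qed.

Lemma lstateB x y : f (x - y) = f x - f y.
Proof. by rewrite lstateD lstateN. Qed.

Lemma lstate_sum I (r : seq I) (P : pred I) (F : I -> bop) :
  f (\sum_(i <- r | P i) F i) = \sum_(i <- r | P i) f (F i).
Proof. by apply: (big_morph f lstateD lstate0). Qed.

Lemma lstate_le A B : op_le A B -> f A <= f B.
Proof. by move=> AB; rewrite -subr_ge0 -lstateB; exact: lstate_ge0. Qed.

Lemma lstate_Re_ge0 A : op_pos A -> 0 <= Re (f A).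
Proof. by move=> /lstate_ge0 /ge0_complexP[]. Qed.

Lemma lstate_Im A : op_pos A -> Im (f A) = 0.
Proof. by move=> /lstate_ge0 /ge0_complexP[]. Qed.

Lemma lstate_Re_le A B : op_le A B -> Re (f A) <= Re (f B).
Proof. by move=> /lstate_le; rewrite lecE => /andP[]. Qed.

Lemma lstate_cauchy (A B : bop) :
  sqmod (f (compop (adj B) A)) <= Re (f (compop (adj B) B)) * Re (f (compop (adj A) A)).
Proof.
apply: (@posform_cauchy R bop (fun B A => f (compop (adj B) A))).
- by move=> x a y z; rewrite compop_linear lstateP.
- by move=> x y a z; rewrite adj_conjlinear compop_semilinear lstateP.
- by move=> x; exact/lstate_ge0/op_pos_adj.
Qed.

Lemma lstate_sq_le K (A : bop) : sqbounded K A -> Re (f (compop (adj A) A)) <= K.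
Proof.
move=> /sqbounded_le/lstate_Re_le; rewrite lstateZ lstate1 mulr1.
exact: le_trans.
Qed.

Lemma lstate_bound K (A : bop) : sqbounded K A -> sqmod (f A) <= K.
Proof.
move=> AK; have := lstate_cauchy A idop; rewrite adj_id.
have cid B : compop idop B = B by exact: bop_ext_fun.
rewrite !cid lstate1 /= mul1r => /le_trans; apply; exact: lstate_sq_le.
Qed.

Lemma sqbounded_interval n m : sqbounded 1 (interval_proj R n m).
Proof.
split=> // x; rewrite mul1r -lecR -!inner_norm -adjPr adj_interval.
rewrite -compopE interval_proj_idem.
by have /op_leP/(_ x) := @interval_le_id R n m.
Qed.

(** With [Q = 1 - P], the difference is [Q x + P x Q]. Cauchy-Schwarz bounds the squared modulus of
    [f] on each summand by [K * f Q], and squaring the sum costs a factor 4. Operators can thus be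
    replaced by finite corners at the price of the mass outside. *)
Lemma lstate_corner K n m (x : bop) : let P := interval_proj R n m in
  sqbounded K x ->
  sqmod (f (x - compop P (compop x P))) <= 4 * K * Re (f (idop - P)).
Proof.
move=> P xK; set Q := idop - P; have [K0 _] := xK.
have aP : adj P = P := adj_interval R n m.
have PP : compop P P = P := interval_proj_idem R n m.
have aQ : adj Q = Q.
  apply: adj_unique => u v; rewrite !bopB innerDl innerDr innerNl innerNr.
  by rewrite -[inner u (P v)]adjP aP.
have QQ : compop Q Q = Q.
  apply: bop_ext_fun => u; rewrite compopE /Q !bopB !idopE linearB/=.
  by rewrite -(compopE P P) PP subrr subr0.
have -> : x - compop P (compop x P) = compop Q x + compop (compop P x) Q.
  apply: bop_ext_fun => u; rewrite bopB bopD !compopE /Q !bopB !idopE !linearB/=.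
  by rewrite addrA subrK.
have q0 : 0 <= Re (f Q) by apply: lstate_Re_ge0; exact: interval_le_id.
have h1 : sqmod (f (compop Q x)) <= K * Re (f Q).
  have := lstate_cauchy x Q; rewrite aQ QQ => /le_trans; apply.
  by rewrite mulrC; apply: ler_wpM2r => //; exact: lstate_sq_le.
have h2 : sqmod (f (compop (compop P x) Q)) <= K * Re (f Q).
  have := lstate_cauchy Q (adj (compop P x)); rewrite adjK aQ QQ => /le_trans; apply.
  apply: ler_wpM2r => //.
  rewrite -{1}[compop P x]adjK; apply: lstate_sq_le; apply: sqbounded_adj.
  by rewrite -[K]mul1r; apply: sqbounded_comp => //; exact: sqbounded_interval.
rewrite lstateD; apply: le_trans (sqmodD_le _ _) _.
set r := Re (f Q) in q0 h1 h2 *; lra.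
Qed.

Lemma lstate_corner_sum n m (x : bop) : let P := interval_proj R n m in
  f (compop P (compop x P)) =
  \sum_(n <= i < m.+1) \sum_(n <= j < m.+1) x (e_ j) i * f (mxunit R i j).
Proof.
move=> P; transitivity (f (\sum_(n <= i < m.+1) \sum_(n <= j < m.+1)
    x (e_ j) i *: mxunit R i j)); last first.
  rewrite lstate_sum; apply: eq_bigr => i _.
  by rewrite lstate_sum; apply: eq_bigr => j _; rewrite lstateZ.
congr f; apply: bop_ext_fun => u.
rewrite !compopE {1}/P /interval_proj !bop_sum; apply: eq_bigr => i _.
rewrite mxunitE !bop_sum.
rewrite linear_sum/= ell2_sum scaler_suml.
apply: eq_bigr => j _.
by rewrite mxunitE linearZ/= bopZ mxunitE ell2Z scalerA mulrC.
Qed.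

(* Evaluating f on the positive operator |v><v| with v = s e_n - t eta^* e_m. *)
Lemma lstate_offdiag n m (eta : C) (s t : R) :
  s * t * Re (eta * f (mxunit R n m) + eta^* * f (mxunit R m n)) <=
  s ^+ 2 * Re (f (mxunit R n n)) + t ^+ 2 * sqmod eta * Re (f (mxunit R m m)).
Proof.
set c := f (mxunit R n m); set c' := f (mxunit R m n).
pose A : bop := (s ^+ 2)%:C *: mxunit R n n + (t ^+ 2 * sqmod eta)%:C *: mxunit R m m -
  (s * t)%:C *: (eta *: mxunit R n m + eta^* *: mxunit R m n).
have A0 : op_pos A.
  move=> x; pose z : C := s%:C * x n - t%:C * eta * x m.
  suff -> : inner x (A x) = (sqmod z)%:C by rewrite ler0c sqmod_ge0.
  rewrite -mulJz /z cJD cJN !cJM !conj_real.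
  rewrite /A !(bopD, bopN, bopZ, mxunitE) !(innerDr, innerNr, innerZr, inner_ebasisr).
  have -> : (s ^+ 2)%:C = s%:C * s%:C by exact: real_complexM.
  have -> : (t ^+ 2 * sqmod eta)%:C = t%:C * t%:C * (eta^* * eta).
    by rewrite mulJz real_complexM; congr (_ * _); exact: real_complexM.
  by rewrite real_complexM; ring.
have := lstate_Re_ge0 A0; rewrite /A lstateB !(lstateD, lstateZ) -/c -/c'.
rewrite !(cReD, cReN, cReM, cImD, cImM) /=; lra.
Qed.

End OneState.

Lemma lstate_comp f (S : bop -> bop) : linear_state f ->
  (forall a x y, S (a *: x + y) = a *: S x + S y) -> S idop = idop ->
  (forall A, op_pos A -> op_pos (S A)) -> linear_state (fun x => f (S x)).
Proof.
move=> sf Sl S1 S0; split=> [a x y||A A0].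
- by rewrite Sl (lstateP sf).
- by rewrite S1 (lstate1 sf).
- exact/(lstate_ge0 sf)/S0.
Qed.

Lemma vector_state n : linear_state (fun A : bop => A (e_ n) n).
Proof.
split=> [a x y||A A0]; first by rewrite bopD bopZ ell2D ell2Z.
  by rewrite idopE ebasisE eqxx.
exact: cdiag_ge0.
Qed.

(** * Ultralimits of states and invariant states by averaging *)

Lemma fmap_ultra (I J : Type) (F : set_system I) (u : I -> J) :
  UltraFilter F -> UltraFilter (u @ F).
Proof.
move=> UF; split=> [|G PG uFG]; first exact: fmap_proper_filter.
apply/seteqP; split=> // A GA; have [//|FA] := in_ultra_setVsetC (u @^-1` A) UF.
have GcA : G (~` A) by exact: uFG.
have FG : Filter G by exact: PG.
have := filterI GA GcA; rewrite setICr => /(_ FG) G0; exfalso; exact: (filter_not_empty G G0).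
Qed.

Lemma ultra_cvg (I : Type) (F : set_system I) (u : I -> R) (M : R) :
  UltraFilter F -> (forall i, `|u i| <= M) -> cvg (u @ F).
Proof.
move=> UF uM; have := @segment_compact R (- M) M.
rewrite compact_ultra => /(_ _ (fmap_ultra u UF))[].
  by apply: (filterE (F := F)) => i; have := uM i; rewrite ler_norml /= in_itv.
by move=> l [_ ul]; apply/cvg_ex; exists l.
Qed.

Lemma ultra_ccvg (I : Type) (F : set_system I) (u : I -> C) (M : R) :
  UltraFilter F -> (forall i, sqmod (u i) <= M) -> exists l, ccvg F u l.
Proof.
move=> UF uM.
have M1 i : sqmod (u i) <= (1 + `|M|) ^+ 2.
  have Mle := ler_norm M; have M0 := normr_ge0 M; have uMi := uM i.
  by rewrite sqrrD expr1n mul1r; have := sqr_ge0 (`|M|); lra.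
have M0 : 0 <= 1 + `|M| by rewrite addr_ge0.
have /cvg_ex[a ua] := ultra_cvg UF (fun i => normRe_le M0 (M1 i)).
have /cvg_ex[b ub] := ultra_cvg UF (fun i => normIm_le M0 (M1 i)).
by exists (a +i* b).
Qed.

(** Weak-* compactness of the state space: at each operator the values stay in a bounded set, and
    the defining properties of a state pass to pointwise limits. Normality does not. *)
Lemma state_ultralimit (I : Type) (F : set_system I) (f : I -> bop -> C) :
  UltraFilter F -> (forall i, linear_state (f i)) ->
  exists2 g, linear_state g & forall x, ccvg F (f^~ x) (g x).
Proof.
move=> UF sf.
have /choice[g gP] (x : bop) : exists l, ccvg F (f^~ x) l.
  have [K xK] := bop_sqbounded x.
  exact: (ultra_ccvg UF (fun i => lstate_bound (sf i) xK)).
exists g => //; split=> [a x y||A A0].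
- apply: (ccvg_unique (gP _)).
  rewrite [X in ccvg _ X](_ : _ = (fun i => a * f i x + f i y)); last first.
    by apply/funext => i; exact: (lstateP (sf i)).
  by apply: ccvgD => //; apply: ccvgM => //; exact: ccvg_cst.
- apply: (ccvg_unique (gP _)).
  rewrite [X in ccvg _ X](_ : _ = (fun i => 1)); last first.
    by apply/funext => i; exact: (lstate1 (sf i)).
  exact: ccvg_cst.
- apply: (ccvg_ge0 (gP A)); apply: filterE => i; exact: (lstate_ge0 (sf i)).
Qed.

Lemma nat_ultrafilter : exists2 F : set_system nat, UltraFilter F & \oo `<=` F.
Proof. by have [G [UG sG]] := @ultraFilterLemma nat \oo _; exists G. Qed.

(* Cesaro means along the orbit of a vector state. *)
Lemma invariant_linear_state (S : bop -> bop) :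
  (forall a x y, S (a *: x + y) = a *: S x + S y) -> S idop = idop ->
  (forall A, op_pos A -> op_pos (S A)) ->
  exists2 g, linear_state g & forall x, g (S x) = g x.
Proof.
move=> Sl S1 S0.
pose f k (x : bop) : C := iter k S x (e_ 0%N) 0%N.
have sf k : linear_state (f k).
  rewrite /f; elim: k => [|k IH]; first exact: (vector_state 0).
  by under eq_fun do rewrite iterSr; exact: (lstate_comp IH).
pose h n (x : bop) : C := n.+1%:R^-1 * \sum_(0 <= k < n.+1) f k x.
have n0 n : (n.+1%:R : C) != 0 by rewrite pnatr_eq0.
have sh n : linear_state (h n).
  split=> [a x y||A A0].
  - rewrite /h mulrCA -mulrDr; congr (_ * _); rewrite mulr_sumr -big_split/=.
    by apply: eq_bigr => k _; rewrite (lstateP (sf k)).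
  - rewrite /h (eq_bigr (fun=> 1)); last by move=> k _; rewrite (lstate1 (sf k)).
    by rewrite sumr_const_nat subn0 mulVf.
  - rewrite /h mulr_ge0 ?invr_ge0 ?ler0n// sumr_ge0// => k _.
    exact: (lstate_ge0 (sf k)).
have [F UF Foo] := nat_ultrafilter.
have [g sg gP] := state_ultralimit UF sh; exists g => // x.
have [K xK] := bop_sqbounded x; have K0 := xK.1.
apply/eqP; rewrite -subr_eq0; apply/eqP.
apply: (ccvg_unique (ccvgD (gP (S x)) (ccvgN (gP x)))).
apply: ccvg0P.
have hE n : h n (S x) - h n x = n.+1%:R^-1 * (f n.+1 x - f 0%N x).
  rewrite /h -mulrBr -sumrB; congr (_ * _).
  rewrite -(@telescope_sumr _ 0 n.+1 (fun k => f k x))//.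
  by apply: eq_bigr => k _; rewrite /f iterSr.
have bound n : sqmod (h n (S x) - h n x) <= 4 * K * n.+1%:R^-1.
  rewrite hE sqmodM.
  have -> : (n.+1%:R^-1 : C) = (n.+1%:R^-1)%:C by rewrite fmorphV rmorph_nat.
  rewrite sqmod_real mulrC.
  have h1 : sqmod (f n.+1 x - f 0%N x) <= 4 * K.
    apply: le_trans (sqmodD_le _ _) _; rewrite sqmodN.
    by have := lstate_bound (sf n.+1) xK; have := lstate_bound (sf 0%N) xK; lra.
  have i0 : 0 <= (n.+1%:R^-1 : R) by rewrite invr_ge0 ler0n.
  have i1 : (n.+1%:R^-1 : R) <= 1 by rewrite invf_le1 ?ltr0n// ler1n.
  by apply: ler_pM; rewrite ?sqmod_ge0 ?sqr_ge0 ?expr2 ?ler_piMr.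
apply: (squeeze_cvgr _ (cvg_cst 0)); last first.
  have : (fun n => 4 * K * (n.+1%:R^-1 : R)) @ \oo --> (0 : R).
    rewrite -[X in _ --> X](mulr0 (4 * K)).
    by apply: cvgM; [exact: cvg_cst|exact: cvg_harmonic].
  by move=> cv A nA; exact: (Foo _ (cv A nA)).
by apply: filterE => n; rewrite sqmod_ge0 bound.
Qed.

End States.

(** * Suprema of directed families, and normality of tight states *)

Section Normality.
Variable R : realType.
Local Notation C := R[i].
Local Notation H := (ell2 R).
Local Notation Re := (@complex.Re R).
Local Notation Im := (@complex.Im R).
Local Notation e_ := (ebasis R).
Local Notation bop := (bop R).
Local Notation idop := (idop R).

Lemma op_pos_Re (A : bop) x : op_pos A -> 0 <= Re (inner x (A x)).
Proof. by move=> /(_ x)/ge0_complexP[]. Qed.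

Lemma diag_Re_ge0 (A : bop) n : op_pos A -> 0 <= Re (A (e_ n) n).
Proof. by move=> /(op_pos_Re (e_ n)); rewrite inner_ebasis. Qed.

Lemma hnormZ (c : C) (x : H) : hnorm (c *: x) ^+ 2 = sqmod c * hnorm x ^+ 2.
Proof.
apply: complexI; rewrite -inner_norm innerZl innerZr inner_norm mulrA mulJz.
exact/esym/real_complexM.
Qed.

Lemma rank_one_bounded_linear (u : H) : (fun x => inner u x *: u) \in @bounded_linear R.
Proof.
apply/asboolP; split=> [a x y|]; first by rewrite inner_linear scalerDl scalerA.
exists (hnorm u ^+ 2) => x.
rewrite -(@ler_pXn2r R 2) ?nnegrE ?mulr_ge0 ?hnorm_ge0 ?sqr_ge0//.
have -> : (hnorm u ^+ 2 * hnorm x) ^+ 2 = hnorm u ^+ 2 * hnorm x ^+ 2 * hnorm u ^+ 2 by ring.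
rewrite hnormZ.
by apply: ler_wpM2r; [exact: sqr_ge0|exact: inner_cauchy].
Qed.

Definition rank_one (u : H) : bop := Bop (rank_one_bounded_linear u).

Lemma rank_oneE (u x : H) : inner x (rank_one u x) = (sqmod (inner u x))%:C.
Proof.
have -> : rank_one u x = inner u x *: u by [].
by rewrite innerZr -(innerJ u x) mulrC mulJz.
Qed.

Lemma op_form_bound (S : bop) : exists2 K : R, 0 < K &
  forall x, Re (inner x (S x)) <= K * hnorm x ^+ 2.
Proof.
have [K [K0 SK]] := bop_sqbounded S.
(* Stands in for the square root of [K], as [K <= (1 + K)^2], and is positive, which later divisions
   require. *)
exists (1 + K) => [|x]; first by rewrite ltr_pwDl.
apply: le_trans (ler_norm _) _; apply: normRe_le.
  by rewrite mulr_ge0 ?sqr_ge0// addr_ge0.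
apply: le_trans (inner_cauchy _ _) _.
have h0 := sqr_ge0 (hnorm x).
apply: le_trans (ler_wpM2l h0 (SK x)) _; set h := hnorm x ^+ 2 in h0 *.
have -> : h * (K * h) = K * (h * h) by ring.
rewrite exprMn [h ^+ 2]expr2; apply: ler_wpM2r; first exact: mulr_ge0.
by rewrite sqrrD expr1n mul1r; have := sqr_ge0 K; lra.
Qed.

Lemma op_le_form (A B : bop) K x : op_le A B ->
  Re (inner x (B x)) <= K -> Re (inner x (A x)) <= K.
Proof. by move=> /op_leP/(_ x); rewrite lecE => /andP[_ AB]; exact: le_trans. Qed.

(* Otherwise the weak limit u of (S - A) e_i along D yields a nonzero rank one
   operator below every S - A. *)
Lemma lub_diag (D : set bop) (S : bop) (i : nat) (d : R) :
  directed D -> (forall A, D A -> op_pos A) -> is_lub (@op_le R) D S -> 0 < d ->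
  exists2 A, D A & Re ((S - A) (e_ i) i) < d.
Proof.
move=> [[A0 DA0] dirD] posD [ubS lubS] d0; apply: contrapT => noA.
have dA A : D A -> d <= Re ((S - A) (e_ i) i).
  by move=> DA; rewrite leNgt; apply/negP => h; apply: noA; exists A.
have [K K0 SK] := op_form_bound S.
pose I := {B : bop | D B}.
pose y (B : I) : bop := S - sval B.
have y0 B : op_pos (y B) by exact: ubS (svalP B).
have yS B : op_le (y B) S.
  rewrite /op_le /y opprB addrC subrK; exact: posD (svalP B).
have yK B x : Re (inner x (y B x)) <= K * hnorm x ^+ 2 by exact: op_le_form (SK x).
(* The filter of tails of [D]; directedness makes it closed under intersection. *)
pose F0 : set_system I := [set X | exists A : I, forall B : I, op_le (sval A) (sval B) -> X B].
have F0p : ProperFilter F0.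
  split.
    by move=> [A /(_ A)]; apply; exact: op_le_refl.
  split.
  - by exists (exist _ A0 DA0).
  - move=> X Y [A AX] [B BY].
    have [E [DE AE BE]] := dirD _ _ (svalP A) (svalP B).
    exists (exist _ E DE) => G /= EG; split.
      by apply: AX; exact: op_le_trans EG.
    by apply: BY; exact: op_le_trans EG.
  - by move=> X Y XY [A AX]; exists A => B /AX /XY.
have [F [UF F0F]] := ultraFilterLemma F0p.
have yb B x : sqmod (inner (y B (e_ i)) x) <= K * K * hnorm x ^+ 2.
  apply: le_trans (inner_cauchy _ _) _; apply: ler_wpM2r; first exact: sqr_ge0.
  apply: le_trans (op_pos_sq_le (e_ i) (y0 B) (ltW K0) (yK B)) _.
  apply: ler_wpM2l; first exact: ltW.
  by apply: le_trans (yK _ _) _; rewrite hnorm_ebasis mulr1.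
have /choice[g gP] x : exists l, ccvg F (fun B => inner (y B (e_ i)) x) l.
  exact: (ultra_ccvg UF (fun B => yb B x)).
have [a x z|x|u gu _] := @riesz_bound R g (K * K).
- apply: (ccvg_unique (gP _)).
  rewrite [X in ccvg _ X](_ : _ = (fun B => a * inner (y B (e_ i)) x +
    inner (y B (e_ i)) z)); last by apply/funext => B; rewrite inner_linear.
  by apply: ccvgD => //; apply: ccvgM => //; exact: ccvg_cst.
- by apply: (ccvg_sqmod_le (gP x)); exact: filterE.
(* For [B] above [A], Cauchy-Schwarz for [S - B] bounds the squared modulus of
   [inner (y B (e_ i)) x] by [K] times the form of [S - B] at [x], and [S - B] lies below [S - A].
   The bound survives the limit in [B]. *)
have uy A x : sqmod (inner u x) <= K * Re (inner x (y A x)).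
  rewrite -gu; apply: (ccvg_sqmod_le (gP x)); apply: F0F; exists A => B AB.
  rewrite -innerJ (op_pos_herm (e_ i) x (y0 B)) cJK.
  apply: le_trans (op_pos_cauchy _ _ (y0 B)) _.
  apply: ler_pM; [exact: op_pos_Re|exact: op_pos_Re| |].
    by apply: le_trans (yK _ _) _; rewrite hnorm_ebasis mulr1.
  apply: op_le_form (lexx _); rewrite /op_le /y opprB addrC addrA subrK.
  exact: AB.
have ui : d <= Re (inner u (e_ i)).
  rewrite -gu; have [h _] := gP (e_ i); rewrite -(cvg_lim _ h)//.
  apply: limr_ge; first by apply/cvg_ex; exists (Re (g (e_ i))).
  apply: filterE => B; rewrite inner_ebasisr cReJ; exact: dA (svalP B).
(* By [uy] this operator is an upper bound of [D]; its diagonal entry at [i] is strictly below that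
   of [S], because [inner u (e_ i)] has real part at least [d]. *)
have Suu : op_le S (S - (K^-1)%:C *: rank_one u).
  apply: lubS => A DA; apply/op_leP => x; have := uy (exist _ A DA) x.
  have := y0 (exist _ A DA) x.
  have -> : y (exist _ A DA) x = S x - A x by [].
  rewrite !bopB bopZ !innerDr !innerNr innerZr rank_oneE -real_complexM.
  move: (inner x (S x)) (inner x (A x)) (sqmod _) => [p p'] [q q'] m.
  rewrite subr_ge0 lecE /= => /andP[/eqP -> _] mK.
  rewrite subr0 eqxx/= lerBrDr -lerBrDl -(ler_pM2l K0).
  by rewrite mulrA divff ?mul1r// gt_eqF.
have := Suu (e_ i); rewrite !bopB bopZ !innerDr !innerNr innerZr rank_oneE.
rewrite addrAC subrr add0r -real_complexM lecE/= => /andP[_].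
rewrite oppr_ge0 leNgt => /negP; apply; rewrite mulr_gt0 ?invr_gt0//.
rewrite sqmodE ltr_pwDl ?sqr_ge0// exprn_gt0//; exact: lt_le_trans ui.
Qed.

Lemma directed_diag (D : set bop) (S : bop) (M : nat) (d : R) :
  directed D -> (forall A, D A -> op_pos A) -> is_lub (@op_le R) D S -> 0 < d ->
  exists2 A, D A & forall i, (i < M)%N -> Re ((S - A) (e_ i) i) < d.
Proof.
move=> dirD posD lubS d0; elim: M => [|M [A DA AM]].
  by have [[A DA] _] := dirD; exists A.
have [B DB BM] := lub_diag M dirD posD lubS d0.
have [E [DE AE BE]] := dirD.2 _ _ DA DB.
have mono X i : op_le X E -> Re ((S - E) (e_ i) i) <= Re ((S - X) (e_ i) i).
  move=> /(_ (e_ i)) /ge0_complexP[+ _].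
  by rewrite inner_ebasis !bopB !ell2D !ell2N !cReD !cReN; lra.
exists E => // i; rewrite ltnS leq_eqVlt => /predU1P[->|iM].
  exact: le_lt_trans (mono _ _ BE) BM.
exact: le_lt_trans (mono _ _ AE) (AM _ iM).
Qed.

Lemma sqbounded_mxunit n m : sqbounded 1 (mxunit R n m).
Proof.
split=> // x; rewrite mxunitE hnormZ hnorm_ebasis mulr1 mul1r.
exact: sqmod_le_hnorm.
Qed.

(** Tightness makes [f (S - A)] depend, up to a small error, only on a finite corner of [S - A]. The
    entries of that corner are controlled by its diagonal, which is small for a suitable [A] in
    [D]. *)
Lemma tight_state_normal (f : bop -> C) : linear_state f ->
  (forall e : R, 0 < e -> exists M, Re (f (idop - interval_proj R 0 M)) < e) ->
  normal_map (fun z w : C => z <= w) f.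
Proof.
move=> sf tight D S dirD posD lubS; have [ubS _] := lubS.
split=> [_ [A DA <-]|b ubb]; first exact/(lstate_le sf)/ubS.
have [[A0 DA0] _] := dirD.
have S0 : op_pos S.
  have := op_posD (ubS _ DA0) (posD _ DA0); by rewrite subrK.
(* Comparable complex numbers have equal imaginary parts. *)
have Imb : Im b = 0.
  have : f A0 <= b by apply: ubb; exists A0.
  by rewrite lecE => /andP[/eqP -> _]; exact: lstate_Im (posD _ DA0).
rewrite lecE Imb (lstate_Im sf S0) eqxx/=.
apply/ler_addgt0Pr => e e0.
suff [A DA Ae] : exists2 A, D A & Re (f (S - A)) <= e.
  have : f A <= b by apply: ubb; exists A.
  by rewrite lecE => /andP[_]; move: Ae; rewrite (lstateB sf) cReD cReN; lra.
have [K K0 SK] := op_form_bound S.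
(* Chosen so that [lstate_corner], with square bound [K * K], leaves at most [(e / 2) ^+ 2] outside
   the corner. *)
have [M Me] : exists M, Re (f (idop - interval_proj R 0 M)) < (e / 2) ^+ 2 / (4 * (K * K)).
  by apply: tight; rewrite divr_gt0 ?exprn_gt0 ?divr_gt0 ?mulr_gt0.
pose P := interval_proj R 0 M.
(* The corner has [M.+1 ^ 2] entries, each contributing at most [t]. *)
pose t := e / 2 / (M.+1%:R ^+ 2).
have M0 : 0 < (M.+1%:R : R) by rewrite ltr0n.
have t0 : 0 < t by rewrite !divr_gt0// exprn_gt0.
have [A DA At] := directed_diag M.+1 dirD posD lubS t0.
exists A => //; set y := S - A in At *.
have y0 : op_pos y by exact: ubS.
have yS : op_le y S by rewrite /op_le /y opprB addrC subrK; exact: posD.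
have yK x : Re (inner x (y x)) <= K * hnorm x ^+ 2 by exact: op_le_form (SK x).
have ysq : sqbounded (K * K) y.
  split=> [|x]; first by rewrite mulr_ge0// ltW.
  apply: le_trans (op_pos_sq_le x y0 (ltW K0) yK) _.
  by rewrite -mulrA; apply: ler_wpM2l => //; exact: ltW.
have -> : y = (y - compop P (compop y P)) + compop P (compop y P) by rewrite subrK.
have -> : e = e / 2 + e / 2 by field.
rewrite (lstateD sf) cReD; apply: lerD.
  apply: le_trans (ler_norm _) _; apply: normRe_le; first by rewrite divr_ge0// ltW.
  apply: le_trans (lstate_corner sf 0 M ysq) _.
  by rewrite mulrC -ler_pdivlMr ?mulr_gt0// ltW.
rewrite (lstate_corner_sum sf) cRe_sum.
have -> : e / 2 = \sum_(0 <= i < M.+1) \sum_(0 <= j < M.+1) t.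
  rewrite !sumr_const_nat subn0 -mulrnA -[t *+ _]mulr_natr natrM /t.
  by field; rewrite gt_eqF.
rewrite !big_nat; apply: ler_sum => i /andP[_ iM].
rewrite cRe_sum !big_nat; apply: ler_sum => j /andP[_ jM].
apply: le_trans (ler_norm _) _; apply: normRe_le; first exact: ltW.
rewrite sqmodM -[leRHS]mulr1; apply: ler_pM; rewrite ?sqmod_ge0//; last first.
  exact/(lstate_bound sf)/sqbounded_mxunit.
have := op_pos_cauchy (e_ i) (e_ j) y0; rewrite !inner_ebasis => /le_trans; apply.
by rewrite expr2; apply: ler_pM; rewrite ?diag_Re_ge0//; exact/ltW/At.
Qed.

End Normality.

(** * The image of [p_n] under the chain, and the cut inequality *)

Section BirthDeath.
Variable R : realType.
Local Notation C := R[i].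
Local Notation H := (ell2 R).
Local Notation Re := (@complex.Re R).
Local Notation Im := (@complex.Im R).
Local Notation e_ := (ebasis R).
Local Notation bop := (bop R).
Local Notation idop := (idop R).
Local Notation p_ := (interval_proj R 0).

Lemma cp_pos (T : bop -> bop) (A : bop) :
  completely_positive T -> op_pos A -> op_pos (T A).
Proof.
move=> cpT A0 x.
have := cpT 1%N (const_mx A) _ (fun=> x); rewrite !big_ord1 !mxE; apply=> y.
by rewrite !big_ord1 mxE.
Qed.

Lemma interval_chain_directed : directed [set A | exists m, A = p_ m].
Proof.
split; first by exists (p_ 0), 0%N.
have mono m k : op_le (p_ m) (p_ (m + k)).
  elim: k => [|k IH]; first by rewrite addn0; exact: op_le_refl.
  apply: op_le_trans IH _; rewrite addnS interval_projS// /op_le addrAC subrr add0r.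
  exact: op_pos_mxunit.
move=> _ _ [m ->] [k ->]; exists (p_ (m + k)); split; first by exists (m + k)%N.
  exact: mono.
by rewrite addnC; exact: mono.
Qed.

Lemma inner_interval m (x : H) :
  inner x (p_ m x) = (\sum_(0 <= k < m.+1) sqmod (x k))%:C.
Proof.
rewrite /interval_proj bop_sum inner_sumr rmorph_sum/=; apply: eq_bigr => k _.
by rewrite mxunitE innerZr inner_ebasisr mulrC mulJz.
Qed.

(** The test family on which the normality of [T], and later that of an invariant state, is used. *)
Lemma interval_chain_lub : is_lub (@op_le R) [set A | exists m, A = p_ m] idop.
Proof.
split=> [_ [m ->]|B Bub]; first exact: interval_le_id.
apply/op_leP => x; rewrite idopE inner_norm.
have le m : (\sum_(0 <= k < m.+1) sqmod (x k))%:C <= inner x (B x).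
  by rewrite -inner_interval; have /op_leP := Bub _ (ex_intro _ m erefl); apply.
move: (inner x (B x)) le => [b b'] le.
have {}le m : b' = 0 /\ \sum_(0 <= k < m.+1) sqmod (x k) <= b.
  by have := le m; rewrite lecE /= => /andP[/eqP].
rewrite lecE /= (le 0%N).1 eqxx/= sqr_hnorm.
apply: limr_le; first exact: ell2_cvg.
apply: nearW => -[|n]; last exact: (le n).2.
rewrite /series/= big_geq//; apply: le_trans (le 0%N).2.
by rewrite sumr_ge0// => k _; exact: sqmod_ge0.
Qed.

Variable T : {linear bop -> bop}.
Hypothesis hT : is_qbdc T.

Lemma qbdc_pos A : op_pos A -> op_pos (T A).
Proof. by case: hT => [[_ cpT] _ _]; exact: cp_pos. Qed.

Lemma qbdc_id : T idop = idop.
Proof. by case: hT => [[]]. Qed.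

Lemma qbdc_le A B : op_le A B -> op_le (T A) (T B).
Proof. by move=> AB; rewrite /op_le -linearB; exact: qbdc_pos. Qed.

Lemma qbdc_unit_pos k : op_pos (T (mxunit R k k)).
Proof. exact/qbdc_pos/op_pos_mxunit. Qed.

Lemma qbdc_unit_out k i : ~~ (k.-1 <= i <= k.+1)%N -> T (mxunit R k k) (e_ i) = 0.
Proof.
move=> ki; have [_ _ /(_ k k (leqnn k))[_]] := hT.
rewrite {1}/interval_proj big_nat1 => /op_leP/(_ (e_ i)).
rewrite !inner_ebasis interval_projE (negPf ki) => le0.
apply: op_pos_diag0; first exact: qbdc_unit_pos.
by apply/eqP; rewrite eq_le le0/=; exact: (cdiag_ge0 _ (qbdc_unit_pos k)).
Qed.

Lemma qbdc_intervalS m : T (p_ m.+1) = T (p_ m) + T (mxunit R m.+1 m.+1).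
Proof. by rewrite interval_projS// linearD. Qed.

Lemma qbdc_interval_diag_le1 m i : Re (T (p_ m) (e_ i) i) <= 1.
Proof.
have := qbdc_le (interval_le_id (R := R) 0 m) => /op_leP/(_ (e_ i)).
by rewrite qbdc_id idopE !inner_ebasis ebasisE eqxx lecE => /andP[].
Qed.

(** By normality the operators [T (p_ k)] have supremum 1, so their diagonal entries at [i] come
    arbitrarily close to 1. They no longer change for [k >= m], since the further units are mapped
    outside row [i]. *)
Lemma qbdc_interval_diag m i : (i < m)%N -> T (p_ m) (e_ i) i = 1.
Proof.
move=> im; have P0 k : op_pos (T (p_ k)) by exact/qbdc_pos/op_pos_interval.
have stable k : Re (T (p_ (m + k)) (e_ i) i) = Re (T (p_ m) (e_ i) i).
  elim: k => [|k IH]; first by rewrite addn0.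
  rewrite addnS qbdc_intervalS bopD ell2D cReD IH qbdc_unit_out ?addr0//.
  by rewrite /= leqNgt ltn_addr.
have mono k l : Re (T (p_ k) (e_ i) i) <= Re (T (p_ (k + l)) (e_ i) i).
  elim: l => [|l IH]; first by rewrite addn0.
  apply: le_trans IH _; rewrite addnS qbdc_intervalS bopD ell2D cReD lerDl.
  by apply: diag_Re_ge0; exact: qbdc_unit_pos.
have [_ Tn _] := hT.
pose D := [set A | exists m, A = p_ m].
have posD A : D A -> op_pos A by move=> [k ->]; exact: op_pos_interval.
have := Tn D idop interval_chain_directed posD interval_chain_lub.
rewrite qbdc_id => lubT.
have dirT : directed (T @` D).
  have [[A0 DA0] dirD] := interval_chain_directed.
  split; first by exists (T A0), A0.
  move=> _ _ [A DA <-] [B DB <-]; have [E [DE AE BE]] := dirD _ _ DA DB.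
  by exists (T E); split; [exists E|exact: qbdc_le|exact: qbdc_le].
have posT A : (T @` D) A -> op_pos A by move=> [B /posD B0 <-]; exact: qbdc_pos.
have ge1 : 1 <= Re (T (p_ m) (e_ i) i).
  apply/ler_addgt0Pr => d d0.
  have [_ [_ [k ->] <-]] := lub_diag i dirT posT lubT d0.
  rewrite bopB ell2D ell2N idopE ebasisE eqxx cReD cReN/=.
  by have := mono k m; rewrite addnC stable; lra.
apply: complex_ext => /=.
  by apply/eqP; rewrite eq_le ge1 qbdc_interval_diag_le1.
by have /ge0_complexP[] := cdiag_ge0 i (P0 m).
Qed.

Lemma qbdc_interval_in m i : (i < m)%N -> T (p_ m) (e_ i) = e_ i.
Proof.
move=> im; have Q0 : op_pos (idop - T (p_ m)).
  by rewrite -qbdc_id; exact/qbdc_le/interval_le_id.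
have := @op_pos_diag0 R _ i Q0.
rewrite !bopB !idopE ell2D ell2N qbdc_interval_diag// ebasisE eqxx subrr => /(_ erefl).
by move/eqP; rewrite subr_eq0 => /eqP.
Qed.

Lemma qbdc_intervalE m x : T (p_ m) x = \sum_(0 <= k < m.+1) T (mxunit R k k) x.
Proof. by rewrite /interval_proj linear_sum/= bop_sum. Qed.

Lemma qbdc_interval_out m i : (m.+1 < i)%N -> T (p_ m) (e_ i) = 0.
Proof.
move=> mi; rewrite qbdc_intervalE big_nat_cond big1// => k; rewrite andbT => /andP[_ km].
by rewrite qbdc_unit_out// negb_and -!ltnNge (leq_ltn_trans km mi) orbT.
Qed.

Lemma qbdc_interval_edge m : T (p_ m) (e_ m.+1) = T (mxunit R m m) (e_ m.+1).
Proof.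
rewrite qbdc_intervalE big_nat_recr//= big_nat_cond big1 ?add0r// => k.
rewrite andbT => /andP[_ km].
by rewrite qbdc_unit_out// negb_and -!ltnNge ltnS km orbT.
Qed.

Local Notation lam := (rate_lambda T).
Local Notation mu := (rate_mu T).
Local Notation eta := (rate_eta T).

Lemma rate_lambdaE n : T (mxunit R n.+1 n.+1) (e_ n) n = (lam n)%:C.
Proof.
rewrite /rate_lambda trace_mxunit; apply: complex_ext => //=.
by have /ge0_complexP[] := cdiag_ge0 n (qbdc_unit_pos n.+1).
Qed.

Lemma rate_muE n : T (mxunit R n n) (e_ n.+1) n.+1 = (mu n.+1)%:C.
Proof.
rewrite /rate_mu trace_mxunit; apply: complex_ext => //=.
by have /ge0_complexP[] := cdiag_ge0 n.+1 (qbdc_unit_pos n).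
Qed.

Lemma rate_etaE n : T (mxunit R n n) (e_ n.+1) n = eta n.
Proof. by rewrite /rate_eta trace_mxunit. Qed.

Lemma qbdc_unit_diag_le1 k i : Re (T (mxunit R k k) (e_ i) i) <= 1.
Proof.
have h : op_le (mxunit R k k) idop.
  by have := interval_le_id (R := R) k k; rewrite /interval_proj big_nat1.
have := qbdc_le h => /op_leP/(_ (e_ i)).
by rewrite qbdc_id idopE !inner_ebasis ebasisE eqxx lecE => /andP[].
Qed.

Lemma rate_lambda_ge0 n : 0 <= lam n.
Proof. by have := cdiag_ge0 n (qbdc_unit_pos n.+1); rewrite rate_lambdaE ler0c. Qed.

Lemma rate_mu_ge0 n : 0 <= mu n.
Proof.
case: n => [//|n]; by have := cdiag_ge0 n.+1 (qbdc_unit_pos n); rewrite rate_muE ler0c.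
Qed.

Lemma rate_lambda_le1 n : lam n <= 1.
Proof. by have := qbdc_unit_diag_le1 n.+1 n; rewrite rate_lambdaE. Qed.

Lemma rate_mu_le1 n : mu n <= 1.
Proof. by case: n => [|n]; [exact: ler01|have := qbdc_unit_diag_le1 n n.+1; rewrite rate_muE]. Qed.

(** Columns below [n] and beyond [n.+1] are already known. Hermiticity supplies the entries of the
    two remaining columns outside the block. Inside it, [mu] and [eta] are entries of
    [T (mxunit R n n)], and the entry at [n] is [1 - lam n] because that of [T (p_ n.+1)] is 1. *)
Lemma qbdc_interval n : T (p_ n) = p_ n +
  (- (lam n)%:C *: mxunit R n n + (mu n.+1)%:C *: mxunit R n.+1 n.+1 +
   (eta n *: mxunit R n n.+1 + (eta n)^* *: mxunit R n.+1 n)).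
Proof.
have P0 : op_pos (T (p_ n)) by exact/qbdc_pos/op_pos_interval.
apply: bop_ext => j; apply: ell2_ext => k.
rewrite !bopD !bopZ !mxunitE !ell2D !ell2Z !ebasisE interval_projE ebasisE.
have nn1 : (n == n.+1) = false by rewrite ltn_eqF.
have n1n : (n.+1 == n) = false by rewrite gtn_eqF.
pose bs := (mulr0n, mulr1n, mul0r, mulr0, mul1r, mulr1, addr0, add0r).
have [jn|nj|->] := ltngtP j n.
- rewrite qbdc_interval_in// ebasisE (gtn_eqF (ltnW jn : (j < n.+1)%N)) /= !bs.
  by case: leqP => //= nk; rewrite gtn_eqF ?(ltn_trans jn).
- move: nj; rewrite leq_eqVlt => /predU1P[<-|nj].
    rewrite qbdc_interval_edge eqxx /= !bs.
    have [kn|nk|->] := ltngtP k n.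
    + rewrite -qbdc_interval_edge (op_pos_entry_herm _ _ P0) qbdc_interval_in//.
      rewrite ebasisE gtn_eqF ?(ltn_trans kn)// cJ0 (ltn_eqF (ltnW kn : (k < n.+1)%N)).
      by rewrite /= !bs.
    + move: nk; rewrite leq_eqVlt => /predU1P[<-|nk].
        by rewrite rate_muE eqxx /= !bs.
      rewrite -qbdc_interval_edge (op_pos_entry_herm _ _ P0) qbdc_interval_out//.
      by rewrite cJ0 (gtn_eqF nk) /= !bs.
    + by rewrite rate_etaE nn1 /= !bs.
  rewrite qbdc_interval_out// (ltn_eqF nj) /= !bs.
  by case: leqP => //= kn; rewrite ltn_eqF// (leq_ltn_trans kn)// ltnW.
- rewrite n1n /= !bs.
  have [kn|nk|->] := ltngtP k n.
  + rewrite (op_pos_entry_herm _ _ P0) qbdc_interval_in//.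
    rewrite ebasisE gtn_eqF// cJ0 (ltn_eqF (ltnW kn : (k < n.+1)%N)).
    by rewrite /= !bs.
  + move: nk; rewrite leq_eqVlt => /predU1P[<-|nk].
      by rewrite (op_pos_entry_herm _ _ P0) qbdc_interval_edge rate_etaE eqxx /= !bs.
    rewrite (op_pos_entry_herm _ _ P0) qbdc_interval_out//.
    by rewrite cJ0 (gtn_eqF nk) /= !bs.
  + have := @qbdc_interval_diag n.+1 n (ltnSn n).
    rewrite qbdc_intervalS bopD ell2D rate_lambdaE nn1 /= !bs.
    by move=> <-; rewrite addrK.
Qed.

(* Stationarity across the cut between n and n+1: the classical flow equals a
   coherent term, which positivity bounds by the two neighbouring weights. *)
Lemma flow_bound (f : bop -> C) n (s t : R) :
  linear_state f -> f (T (p_ n)) = f (p_ n) ->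
  s * t * (lam n * Re (f (mxunit R n n)) - mu n.+1 * Re (f (mxunit R n.+1 n.+1))) <=
  s ^+ 2 * Re (f (mxunit R n n)) +
  t ^+ 2 * sqmod (eta n) * Re (f (mxunit R n.+1 n.+1)).
Proof.
move=> sf; rewrite qbdc_interval (lstateD sf).
rewrite -[X in _ = X -> _]addr0 => /addrI; rewrite !(lstateD sf) !(lstateZ sf) => E.
apply: le_trans (lstate_offdiag sf n n.+1 (eta n) s t).
suff -> : lam n * Re (f (mxunit R n n)) - mu n.+1 * Re (f (mxunit R n.+1 n.+1)) =
    Re (eta n * f (mxunit R n n.+1) + (eta n)^* * f (mxunit R n.+1 n)) by [].
move/(congr1 Re): E; rewrite cReD; set w := _ + _ * f (mxunit R n.+1 n).
by rewrite cReD !cReM cReN cImN /=; lra.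
Qed.

End BirthDeath.

(** * Lower limits, slack in the threshold, and geometric decay of sequences *)

Section RealEstimates.
Variable R : realType.

Lemma limn_einf_near (u : nat -> \bar R) (a : \bar R) : (a < limn_einf u)%E ->
  exists N, forall n, (N <= n)%N -> (a < u n)%E.
Proof.
rewrite limn_einf_lim (cvg_lim _ (@cvg_einfs_sup R u))// => /ereal_sup_gt[_ [N _ <-] aN].
exists N => n Nn; apply: lt_le_trans aN _; rewrite /einfs/=.
by apply: ereal_inf_lbound; exists n.
Qed.

(** The multiplied form also covers vanishing coherence: for [y = 0] it reduces to [0 <= x]. *)
Lemma quotient_gt (a x y : R) : 0 <= x -> 0 <= y ->
  (a%:E < x%:E / y%:E)%E -> a * y <= x.
Proof.
move=> x0; rewrite le_eqVlt => /predU1P[<-|y0]; first by rewrite mulr0.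
by rewrite inver gt_eqF// -EFinM lte_fin ltr_pdivlMr// => /ltW.
Qed.

(** Makes room above [exp (- k)] for two numbers: [q1 ^+ n] will dominate the weights, [q] will be
    the contraction factor, and [q1 / q < 1] the decay rate. *)
Lemma kappa_slack (k L : \bar R) : (0 < k)%E ->
  (expeR (- k) / (1 - expeR (- k)) ^+ 2 < L)%E ->
  exists q1 q : R, [/\ 0 < q1, q1 < q, q < 1, ((- ln q1)%:E < k)%E &
    ((q / (1 - q) ^+ 2)%:E < L)%E].
Proof.
move=> k0 kL.
have E (q : R) : q < 1 -> (q%:E / (1 - q%:E) ^+ 2)%E = (q / (1 - q) ^+ 2)%:E.
  by move=> q1; rewrite -EFinB -EFin_expe inver sqrf_eq0 subr_eq0 gt_eqF.
have [q0 [q00 q01 q0k q0L]] : exists q0 : R, [/\ 0 <= q0, q0 < 1,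
    forall q1, q0 < q1 -> ((- ln q1)%:E < k)%E & ((q0 / (1 - q0) ^+ 2)%:E < L)%E].
  case: k k0 kL => [k k0 kL|_ kL|//]; last first.
    (* For infinite [k], [exp (- k)] is 0 and every real lies below [k]. *)
    exists 0; split=> //; first by move=> q1 _; exact: ltry.
    by rewrite -E.
  have q1 : expR (- k) < 1 by rewrite -expR0 ltr_expR oppr_lt0 -lte_fin.
  exists (expR (- k)); split; [exact: expR_ge0|exact: q1| |by rewrite -E].
  move=> q kq; rewrite lte_fin ltrNl -(expRK (- k)) ltr_ln// posrE ?expR_gt0//.
    exact: lt_trans (expR_gt0 _) kq.
have [l lL Fl] : exists2 l : R, (l%:E <= L)%E & q0 / (1 - q0) ^+ 2 < l.
  case: L q0L {kL} => [l|_|//]; first by rewrite lte_fin => ?; exists l.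
  by exists (q0 / (1 - q0) ^+ 2 + 1); rewrite ?leey// ltrDl.
have s0 : 0 < 1 - q0 by rewrite subr_gt0.
have l0 : 0 < l by apply: le_lt_trans Fl; rewrite divr_ge0// sqr_ge0.
move: Fl; rewrite ltr_pdivrMr ?exprn_gt0// -subr_gt0; set p := _ - q0 => p0.
(* Explicit continuity: passing from [q0] to [q0 + e] changes [p = l (1 - q0)^2 - q0] into
   [p - e c + l e^2]. The bound on [e] by [p / (2 c)] keeps this positive, the one by [(1 - q0) / 2]
   keeps [q < 1]. *)
pose c := 2 * l * (1 - q0) + 1.
have c0 : 0 < c by rewrite addr_gt0// !mulr_gt0.
pose e := Num.min ((1 - q0) / 2) (p / 2 / c).
have e0 : 0 < e by rewrite lt_min !divr_gt0.
have e1 : e <= (1 - q0) / 2 by rewrite ge_min lexx.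
have e2 : e * c <= p / 2 by rewrite -ler_pdivlMr// ge_min lexx orbT.
exists (q0 + e / 2), (q0 + e); split; [lra|lra|lra|apply: q0k; lra|].
apply: lt_le_trans lL; rewrite lte_fin ltr_pdivrMr; last by apply: exprn_gt0; lra.
have le2 : 0 <= l * e ^+ 2 by rewrite mulr_ge0 ?sqr_ge0// ltW.
have -> : l * (1 - (q0 + e)) ^+ 2 = p - e * c + q0 + e + l * e ^+ 2 by rewrite /p /c; ring.
by lra.
Qed.

(** Detailed balance of [w] turns the step inequality into monotonicity: [q ^+ n * x n / w n] does
    not increase between [N0] and [N]. The constants precede [N] and [x], so the decay is uniform
    over all truncations. *)
Lemma ratio_decay (q1 q : R) (w : nat -> R) (a b : nat -> R) (N0 : nat) :
  0 < q1 -> q1 < q -> q < 1 ->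
  (forall n, 0 < w n) -> (forall n, (N0 <= n)%N -> w n <= q1 ^+ n) ->
  (forall n, 0 < a n) -> (forall n, 0 < b n) ->
  (forall n, w n.+1 * b n = w n * a n) ->
  exists c r : R, [/\ 0 < c, 0 < r, r < 1 & forall (N : nat) (x : nat -> R),
    (forall n, 0 <= x n <= 1) ->
    (forall n, (N0 <= n)%N -> (n < N)%N -> q * b n * x n.+1 <= a n * x n) ->
    (forall n, (N < n)%N -> x n = 0) ->
    forall n, x n <= c * r ^+ n].
Proof.
move=> q10 q1q qlt1 w0 wq a0 b0 wab; have q0 : 0 < q by exact: lt_trans q1q.
pose r := q1 / q; have r0 : 0 < r by rewrite divr_gt0.
have r1 : r < 1 by rewrite /r ltr_pdivrMr// mul1r.
have rn n : 0 < r ^+ n by rewrite exprn_gt0.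
have qn n : 0 < q ^+ n by rewrite exprn_gt0.
(* The first term serves [n >= N0]; the second serves [n < N0], where [x n <= 1] is the only
   information. *)
pose c := (w N0)^-1 + (r ^+ N0)^-1.
have [v0 v0'] : 0 < (w N0)^-1 /\ 0 < (r ^+ N0)^-1 by rewrite !invr_gt0.
exists c, r; split=> //; first exact: addr_gt0.
move=> N x x01 step xN n.
have xle1 m : x m <= 1 by have /andP[] := x01 m.
have xge0 m : 0 <= x m by have /andP[] := x01 m.
have [nN0|N0n] := ltnP n N0.
  apply: le_trans (xle1 n) _; rewrite -ler_pdivrMr// div1r.
  apply: (@le_trans _ _ (r ^+ N0)^-1); last by rewrite lerDr ltW.
  by rewrite lef_pV2 ?posrE// ler_wiXn2l ?ltW// ltnW.
have [Nn|nN] := ltnP N n; first by rewrite xN// mulr_ge0 ?ltW// addr_gt0.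
suff main : q ^+ n * x n <= w n / w N0.
  rewrite /r expr_div_n mulrA ler_pdivlMr// mulrC; apply: le_trans main _.
  rewrite [w n / _]mulrC; apply: ler_pM; [exact: ltW|exact: ltW| |exact: wq].
  by rewrite lerDl ltW.
elim: n N0n nN => [|n IH] N0n nN.
  move: N0n; rewrite leqn0 => /eqP ->.
  by rewrite expr0 mul1r divff ?gt_eqF.
move: N0n; rewrite leq_eqVlt => /predU1P[<-|N0n].
  rewrite divff ?gt_eqF //.
  by apply: mulr_ile1; rewrite ?xge0 ?xle1 ?(ltW (qn _)) ?exprn_ile1 ?(ltW q0) ?(ltW qlt1).
have {IH} := IH N0n (ltnW nN); have := step n N0n nN.
rewrite -(ler_pM2l (qn n)) => h1 h2.
rewrite -(ler_pM2l (b0 n)).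
have -> : b n * (w n.+1 / w N0) = a n * (w n / w N0) by rewrite mulrA [b n * _]mulrC wab; ring.
apply: le_trans (_ : a n * (q ^+ n * x n) <= _); last by rewrite ler_pM2l.
by rewrite exprS; apply: le_trans (_ : q ^+ n * (q * b n * x n.+1) <= _); lra.
Qed.

End RealEstimates.

(** * Weights of invariant states, and the vanishing argument of part 2 *)

Section Chain.
Variable R : realType.
Local Notation C := R[i].
Local Notation H := (ell2 R).
Local Notation Re := (@complex.Re R).
Local Notation Im := (@complex.Im R).
Local Notation e_ := (ebasis R).
Local Notation bop := (bop R).
Local Notation idop := (idop R).
Local Notation p_ := (interval_proj R 0).
Variable T : {linear bop -> bop}.
Hypothesis hT : is_qbdc T.
Local Notation lam := (rate_lambda T).
Local Notation mu := (rate_mu T).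
Local Notation eta := (rate_eta T).

Lemma lstate_unit_ge0 (f : bop -> C) n : linear_state f -> 0 <= Re (f (mxunit R n n)).
Proof. by move=> sf; apply: (lstate_Re_ge0 sf); exact: op_pos_mxunit. Qed.

Lemma lstate_interval_sum (f : bop -> C) m : linear_state f ->
  Re (f (p_ m)) = \sum_(0 <= k < m.+1) Re (f (mxunit R k k)).
Proof. by move=> sf; rewrite /interval_proj (lstate_sum sf) cRe_sum. Qed.

Lemma lstate_interval_le1 (f : bop -> C) m : linear_state f -> Re (f (p_ m)) <= 1.
Proof.
move=> sf; have := lstate_Re_le sf (interval_le_id (R := R) 0 m).
by rewrite (lstate1 sf).
Qed.

Lemma lstate_unit_le1 (f : bop -> C) n : linear_state f -> Re (f (mxunit R n n)) <= 1.
Proof.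
move=> sf; apply: le_trans (lstate_interval_le1 n sf).
rewrite (lstate_interval_sum _ sf) big_nat_recr//= lerDr sumr_ge0// => k _.
exact: lstate_unit_ge0.
Qed.

Lemma lstate_interval_mono (f : bop -> C) m n : linear_state f -> (m <= n)%N ->
  Re (f (p_ m)) <= Re (f (p_ n)).
Proof.
move=> sf mn; rewrite !(lstate_interval_sum _ sf) [leRHS](@big_cat_nat _ _ _ m.+1)//=.
by rewrite lerDl sumr_ge0// => k _; exact: lstate_unit_ge0.
Qed.

Lemma lstate_unit_out (f : bop -> C) N n : linear_state f ->
  f (idop - p_ N) = 0 -> (N < n)%N -> Re (f (mxunit R n n)) = 0.
Proof.
case: n => // n sf fN; rewrite ltnS => Nn.
have := lstate_unit_ge0 n.+1 sf; have := lstate_interval_le1 n.+1 sf.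
have := lstate_interval_mono sf Nn.
move: (congr1 Re fN); rewrite (lstateB sf) (lstate1 sf) cReD cReN/=.
by rewrite interval_projS// (lstateD sf) cReD; lra.
Qed.

Lemma lstate_unit_cvg0 (f : bop -> C) : linear_state f ->
  (fun n => Re (f (mxunit R n n))) @ \oo --> (0 : R).
Proof.
move=> sf; apply: cvg_series_cvg_0; apply: nondecreasing_is_cvgn.
  by apply: nondecreasing_series => k _ _; exact: lstate_unit_ge0.
exists 1 => _ [[|m] _ <-]; first by rewrite /series/= big_geq.
by rewrite /series/= -(lstate_interval_sum _ sf); exact: lstate_interval_le1.
Qed.

(* The averaged weights (lam_n + mu_n) x_n / 2 are eventually nondecreasing and
   tend to 0, so x vanishes eventually, hence, backwards, everywhere. *)
Lemma invariant_units_eq0 (f : bop -> C) N : linear_state f ->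
  (forall n, f (T (p_ n)) = f (p_ n)) ->
  (forall n, lam n != 0) ->
  (forall n, (N <= n)%N -> mu n < lam n) ->
  (forall n, (N <= n)%N ->
     4 * sqmod (eta n) <= (lam n - mu n) * (lam n.+1 - mu n.+1)) ->
  forall n, Re (f (mxunit R n n)) = 0.
Proof.
move=> sf inv lam0 ml hN.
pose x n := Re (f (mxunit R n n)).
have x0 n : 0 <= x n by exact: lstate_unit_ge0.
have lamp n : 0 < lam n by rewrite lt_neqAle eq_sym lam0 (rate_lambda_ge0 hT).
pose m n := (lam n + mu n) / 2 * x n.
have mx n : m n <= x n.
  rewrite /m ler_piMl//.
  by have := rate_lambda_le1 hT n; have := rate_mu_le1 hT n; lra.
have mS n : (N <= n)%N -> m n <= m n.+1.
  move=> Nn; have a0 : 0 < lam n - mu n by rewrite subr_gt0 ml.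
  have b0 : 0 < lam n.+1 - mu n.+1 by rewrite subr_gt0 ml// ltnW.
  (* With [a = lam n - mu n] and [b] its successor, this choice and [4 |eta|^2 <= a b] bound twice
     the flow by [a x_n + b x_{n+1}] after division by [a]; rearranged, this is [m n <= m n.+1]. *)
  have := flow_bound hT (lam n - mu n) 2 sf (inv n); rewrite -/(x n) -/(x n.+1).
  have := ler_wpM2r (x0 n.+1) (hN n Nn); rewrite /m.
  move: (x n) (x n.+1) (sqmod _) a0 b0.
  move: (lam n) (lam n.+1) (mu n) (mu n.+1) => l l' k k' y z e a0 b0 h1 h2.
  have h3 : (l - k) * (2 * (l * y - k' * z)) <= (l - k) * ((l - k) * y + (l' - k') * z).
    by lra.
  by move: h3; rewrite ler_pM2l//; lra.
have mono n k : (N <= n)%N -> m n <= m (n + k)%N.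
  move=> Nn; elim: k => [|k IH]; first by rewrite addn0.
  by apply: le_trans IH _; rewrite addnS; apply: mS; rewrite (leq_trans Nn)// leq_addr.
have xN n : (N <= n)%N -> x n = 0.
  move=> Nn; have mn : m n <= 0.
    have xc := lstate_unit_cvg0 sf; rewrite -(cvg_lim _ xc)//.
    apply: limr_ge; first by apply/cvg_ex; exists 0.
    exists n => // k /= nk; apply: le_trans (mx k).
    by rewrite -(subnKC nk); exact: mono.
  have s0 : 0 < (lam n + mu n) / 2.
    by rewrite divr_gt0// ltr_wpDr//; exact: rate_mu_ge0.
  apply/eqP; rewrite eq_le x0 andbT.
  by move: mn; rewrite /m pmulr_rle0.
have back n : x n.+1 = 0 -> x n = 0.
  (* Here the inequality becomes [2 x_n <= x_n]. *)
  move=> xn1; have := flow_bound hT 1 (2 / lam n) sf (inv n).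
  rewrite -/(x n) -/(x n.+1) xn1 !mulr0 subr0 addr0 expr1n mul1r mulrA divfK//.
  by have := x0 n; lra.
move=> n; have [/xN//|nN] := leqP N n.
have : x (n + (N - n))%N = 0 by apply: xN; rewrite subnKC// ltnW.
by elim: (N - n)%N => [|k IH]; [rewrite addn0|rewrite addnS => /back].
Qed.

(** Otherwise 0 bounds all [phi (p_ m)], whose supremum is [phi idop = 1] by normality. *)
Lemma normal_state_unit_neq0 (phi : {scalar bop}) : is_normal_state phi ->
  ~ forall n, Re (phi (mxunit R n n)) = 0.
Proof.
move=> [sphi nphi] x0; have sf := is_state_linear sphi.
have posD A : [set A | exists m, A = p_ m] A -> op_pos A.
  by move=> [k ->]; exact: op_pos_interval.
have [_ /(_ 0)] := nphi _ idop (@interval_chain_directed R) posD (interval_chain_lub R).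
have h : forall a, (phi @` [set A | exists m, A = p_ m]) a -> a <= 0.
  move=> _ [_ [m ->] <-]; rewrite (_ : phi (p_ m) = 0)//.
  rewrite /interval_proj (lstate_sum sf) big1// => k _; apply: complex_ext => //=.
  by apply: (lstate_Im sf); exact: op_pos_mxunit.
by move=> /(_ h); rewrite (lstate1 sf) lecE /= eqxx/= ler10.
Qed.

(** * Truncated chains, their invariant states, and the limit *)

Lemma scalar_of_linear (g : bop -> C) : (forall a x y, g (a *: x + y) = a * g x + g y) ->
  exists phi : {scalar bop}, forall x, phi x = g x.
Proof.
move=> gl; pose m := GRing.isLinear.Build C bop C *%R g gl.
by exists (HB.pack_for {scalar bop} g m).
Qed.

(* Filling the complementary corner with x_NN keeps the truncation unital and
   leaves p_n unchanged for n < N, hence also the balance at every cut below N. *)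
Definition compress N (x : bop) : bop :=
  compop (p_ N) (compop x (p_ N)) + x (e_ N) N *: (idop - p_ N).

Lemma compress_linear N a x y :
  compress N (a *: x + y) = a *: compress N x + compress N y.
Proof.
rewrite /compress compop_semilinear compop_linear bopD bopZ ell2D ell2Z.
by rewrite scalerDl (scalerDr a) scalerA addrACA.
Qed.

Lemma compress_pos N A : op_pos A -> op_pos (compress N A).
Proof.
move=> A0; apply: op_posD; last first.
  by apply: op_posZ; [exact: cdiag_ge0|exact: interval_le_id].
by move=> x; rewrite !compopE -adjP adj_interval.
Qed.

Lemma compress_compl N : compress N (idop - p_ N) = 0.
Proof.
rewrite /compress [X in X *: _](_ : _ = 0); last first.
  by rewrite bopB ell2D ell2N idopE interval_projE ebasisE /= leqnn subrr.
rewrite scale0r addr0; apply: bop_ext_fun => x.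
by rewrite !compopE bopB idopE -compopE interval_proj_idem subrr linear0 bop0.
Qed.

Lemma compress_id N : compress N idop = idop.
Proof.
rewrite /compress idopE ebasisE eqxx scale1r.
have -> : compop (p_ N) (compop idop (p_ N)) = p_ N.
  by rewrite -[RHS]interval_proj_idem; exact: bop_ext_fun.
by rewrite addrC subrK.
Qed.

Lemma compress_interval N n : (n < N)%N -> compress N (p_ n) = p_ n.
Proof.
move=> nN; rewrite /compress interval_projE /= leqNgt nN/= scale0r addr0.
apply: bop_ext_fun => x; apply: ell2_ext => k.
rewrite !compopE !interval_projE /=.
by have [kn|] := leqP k n; [rewrite (leq_trans kn (ltnW nN))|rewrite if_same].
Qed.

(** The last two properties are invariance at [p_ n], which [compress N] fixes, and at
    [idop - p_ N], which it kills. *)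
Lemma truncated_state N : exists f : bop -> C,
  [/\ linear_state f, forall x, f (T (compress N x)) = f x,
      forall n, (n < N)%N -> f (T (p_ n)) = f (p_ n) & f (idop - p_ N) = 0].
Proof.
have [||A A0|f sf fi] := @invariant_linear_state R (fun x => T (compress N x)).
- by move=> a x y; rewrite compress_linear linearP.
- by rewrite compress_id (qbdc_id hT).
- exact/(qbdc_pos hT)/compress_pos.
exists f; split=> //.
  by move=> n nN; rewrite -[RHS]fi compress_interval.
by rewrite -fi compress_compl linear0 (lstate0 sf).
Qed.

(** Without normality, [f (idop - p_ M)] could exceed the sum of the weights beyond [M]. Since [f]
    has all its mass below the cutoff, it is a finite sum, dominated by a geometric series. *)
Lemma tail_bound (f : bop -> C) (c r : R) N : linear_state f -> 0 < c -> 0 < r -> r < 1 ->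
  f (idop - p_ N) = 0 -> (forall n, Re (f (mxunit R n n)) <= c * r ^+ n) ->
  forall M, Re (f (idop - p_ M)) <= c / (1 - r) * r ^+ M.
Proof.
move=> sf c0 r0 r1 fN fn M.
have s0 : 0 < 1 - r by rewrite subr_gt0.
have d0 k : 0 <= c / (1 - r) * r ^+ k by rewrite ltW// mulr_gt0 ?divr_gt0 ?exprn_gt0.
have key k : Re (f (p_ (M + k))) <=
    Re (f (p_ M)) + (c / (1 - r) * r ^+ M - c / (1 - r) * r ^+ (M + k)).
  elim: k => [|k IH]; first by rewrite addn0 subrr addr0.
  rewrite addnS interval_projS// (lstateD sf) cReD.
  have := fn (M + k).+1; move: IH; rewrite !exprS.
  have -> : c / (1 - r) * (r * r ^+ (M + k)) =
    c / (1 - r) * r ^+ (M + k) - c * r ^+ (M + k) by field; rewrite gt_eqF.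
  have : c * (r * r ^+ (M + k)) <= c * r ^+ (M + k).
    by rewrite ler_pM2l// ler_piMl ?exprn_ge0 ?ltW.
  lra.
have E k : Re (f (idop - p_ k)) = 1 - Re (f (p_ k)).
  by rewrite (lstateB sf) (lstate1 sf) cReD cReN.
have eN : Re (f (p_ N)) = 1 by move: (E N); rewrite fN /=; lra.
have [NM|MN] := leqP N M; rewrite E.
  by have := lstate_interval_mono sf NM; have := d0 M; lra.
have := key (N - M)%N; rewrite subnKC ?(ltnW MN)// eN.
by have := d0 N; lra.
Qed.

(** The constant is [2 * 4 + 2]: the corner estimate gives 4, and the filling term gives 1, because
    the entry at [N] has squared modulus at most [K] and the outside mass is at most 1. *)
Lemma compress_defect (f : bop -> C) N K (x : bop) : linear_state f -> sqbounded K x ->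
  sqmod (f (x - compress N x)) <= 10 * K * Re (f (idop - p_ N)).
Proof.
move=> sf xK; rewrite /compress opprD addrA (lstateB sf) (lstateZ sf).
apply: le_trans (sqmodD_le _ _) _; rewrite sqmodN sqmodM.
have h1 := lstate_corner sf 0 N xK.
have Q0 : op_pos (idop - p_ N) by exact: interval_le_id.
have q0 := lstate_Re_ge0 sf Q0.
have q1 : Re (f (idop - p_ N)) <= 1.
  rewrite (lstateB sf) (lstate1 sf) cReD cReN /= lerBlDr lerDl.
  exact/(lstate_Re_ge0 sf)/op_pos_interval.
have qE : sqmod (f (idop - p_ N)) = Re (f (idop - p_ N)) ^+ 2.
  by rewrite sqmodE (lstate_Im sf Q0) expr0n addr0.
have xNN : sqmod (x (e_ N) N) <= K.
  apply: le_trans (sqmod_le_hnorm _ _) _.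
  by rewrite -[K]mulr1 -(hnorm_ebasis R N); exact: xK.2.
rewrite qE; move: h1; set s := sqmod (f _); set q := Re _ in q0 q1 *.
have : sqmod (x (e_ N) N) * q ^+ 2 <= K * q.
  apply: ler_pM => //; [exact: sqmod_ge0|exact: sqr_ge0|].
  by rewrite expr2 ler_piMl.
lra.
Qed.

(** Decay uniform in the cutoff acts twice: it makes the limit tight, and it makes the defect of
    invariance under [T] vanish in the limit. *)
Lemma exists_invariant_state (c r : R) : 0 < c -> 0 < r -> r < 1 ->
  (forall N f, linear_state f -> (forall n, (n < N)%N -> f (T (p_ n)) = f (p_ n)) ->
     f (idop - p_ N) = 0 -> forall n, Re (f (mxunit R n n)) <= c * r ^+ n) ->
  exists phi : {scalar bop},
    [/\ is_normal_state phi, invariant_state T phi & exponential_falloff phi].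
Proof.
move=> c0 r0 r1 fall.
(* Cutoff [N.+1], so that stationarity is available at the cut [p_ N]. *)
have /choice[f fP] N := truncated_state N.+1.
have sf N : linear_state (f N) by case: (fP N).
have fN N n : Re (f N (mxunit R n n)) <= c * r ^+ n.
  by have [s i e z] := fP N; exact: fall s e z n.
pose d := c / (1 - r); have d0 : 0 < d by rewrite divr_gt0// subr_gt0.
have ft N M : Re (f N (idop - p_ M)) <= d * r ^+ M.
  by have [s i e z] := fP N; exact: tail_bound s c0 r0 r1 z (fN N) M.
have [F UF Foo] := nat_ultrafilter.
have [g sg gP] := state_ultralimit UF sf.
have gle x b : (forall N, Re (f N x) <= b) -> Re (g x) <= b.
  move=> fb; have [h _] := gP x; rewrite -(cvg_lim _ h)//.
  by apply: limr_le; [apply/cvg_ex; exists (Re (g x))|exact: filterE].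
have rcvg : (fun n => r ^+ n) @ \oo --> (0 : R).
  by apply: cvg_expr; rewrite ger0_norm ?ltW.
have gi x : g (T x) = g x.
  apply/eqP; rewrite -subr_eq0; apply/eqP.
  apply: (ccvg_unique (ccvgD (gP (T x)) (ccvgN (gP x)))).
  apply: ccvg0P; have [K xK] := bop_sqbounded x; have K0 := xK.1.
  have bound N : sqmod (f N (T x) - f N x) <= 10 * K * (d * r ^+ N).
    have [s i e z] := fP N.
    have sT : linear_state (fun x => f N (T x)).
      apply: (lstate_comp s); [by move=> a u v; rewrite linearP|exact: (qbdc_id hT)|].
      by move=> A; exact: qbdc_pos.
    (* Invariance under the truncation turns the defect into the state [f N \o T] at
       [x - compress N.+1 x]. *)
    rewrite -[f N x]i -(lstateB s) -linearB.
    apply: le_trans (compress_defect N.+1 sT xK) _.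
    apply: ler_wpM2l; first by rewrite mulr_ge0.
    (* The mass of [f N \o T] beyond [N.+1] is at most that beyond [N], which by stationarity equals
       the mass of [f N] beyond [N]. *)
    apply: le_trans (ft N N); rewrite !linearB/= (qbdc_id hT) !(lstateB s) -(e N)//.
    rewrite !cReD !cReN lerD2l lerN2.
    by rewrite (qbdc_intervalS T) (lstateD s) cReD lerDl (lstate_Re_ge0 s)//; exact: qbdc_unit_pos.
  apply: (squeeze_cvgr _ (cvg_cst 0)); last first.
    have : (fun N => 10 * K * (d * r ^+ N)) @ \oo --> (0 : R).
      rewrite -[X in _ --> X](mulr0 (10 * K)); apply: cvgM; first exact: cvg_cst.
      by rewrite -[X in _ --> X](mulr0 d); apply: cvgM; [exact: cvg_cst|].
    by move=> cv A nA; exact: (Foo _ (cv A nA)).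
  by apply: filterE => N; rewrite sqmod_ge0 bound.
have [phi phiE] := scalar_of_linear (lstateP sg).
have phig : (phi : bop -> C) = g by apply/funext.
exists phi; split.
- split; first by split=> [|A A0]; rewrite phiE; [exact: lstate1|exact: lstate_ge0].
  rewrite phig; apply: (tight_state_normal sg) => e e0.
  have dr : (fun n => d * r ^+ n) @ \oo --> (0 : R).
    by rewrite -[X in _ --> X](mulr0 d); apply: cvgM; [exact: cvg_cst|].
  have /cvgrPdist_lt/(_ e e0)[M _ /(_ M (leqnn M))] := dr.
  rewrite /= sub0r normrN ger0_norm; last by rewrite mulr_ge0 ?exprn_ge0 ?ltW.
  by move=> Me; exists M; apply: le_lt_trans Me; apply: gle => N; exact: ft.
- by move=> A; rewrite !phiE gi.
- exists c, (- ln r); split=> //; first by rewrite oppr_gt0 ln_lt0// r0 r1.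
  move=> n; rewrite phiE opprK expRM_natr lnK ?posrE// lecE /=.
  rewrite (lstate_Im sg (op_pos_mxunit n)) eqxx/=.
  by apply: gle => N; exact: fN.
Qed.

End Chain.

(** * Detailed balance weights and the contraction of part 1 *)

Section Weights.
Variables (R : realType) (T : {linear bop R -> bop R}).
Hypothesis hT : is_qbdc T.
Hypothesis lam0 : forall k, 0 < rate_lambda T k.
Hypothesis mu0 : forall k, 0 < rate_mu T k.+1.

Lemma weight_gt0 n : 0 < weight T n.
Proof.
rewrite /weight divr_gt0//; first by apply: prodr_gt0 => k _.
by rewrite big_add1; apply: prodr_gt0 => k _.
Qed.

Lemma weight_recr n : weight T n.+1 * rate_mu T n.+1 = weight T n * rate_lambda T n.
Proof.
rewrite /weight !big_add1; move: (rate_lambda T) (rate_mu T) mu0 => l m m0.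
rewrite !big_nat_recr//=; have M0 : \prod_(0 <= k < n) m k.+1 != 0.
  by rewrite gt_eqF//; apply: prodr_gt0 => k _.
by field; rewrite M0 gt_eqF.
Qed.

Lemma weight_le (q : R) : 0 < q -> ((- ln q)%:E < kappa T)%E ->
  exists N, forall n, (N <= n)%N -> weight T n <= q ^+ n.
Proof.
(* The shift guarantees [n > 0], needed to clear the factor [1 / n]. *)
move=> q0 /limn_einf_near[N hN]; exists N.+1 => n Nn.
have n0 : 0 < (n%:R : R) by rewrite ltr0n (leq_trans _ Nn).
have := hN n (ltnW Nn); rewrite lte_fin lnV ?posrE ?weight_gt0//.
rewrite mulrN ltrN2 ltr_pdivrMl// mulr_natl -lnXn// => /ltW.
by rewrite ler_ln ?posrE ?weight_gt0 ?exprn_gt0.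
Qed.

(* With tau = (1 - q) / (2 q), the cut inequality at s = - lam_n tau and t = 1
   turns the coherence condition into q mu x' <= lam x. *)
Lemma rate_contraction (f : bop R -> R[i]) (q : R) n :
  linear_state f -> f (T (interval_proj R 0 n)) = f (interval_proj R 0 n) ->
  0 < q -> q < 1 ->
  q / (1 - q) ^+ 2 * (4 * sqmod (rate_eta T n)) <= rate_lambda T n * rate_mu T n.+1 ->
  q * rate_mu T n.+1 * complex.Re (f (mxunit R n.+1 n.+1)) <=
  rate_lambda T n * complex.Re (f (mxunit R n n)).
Proof.
move=> sf inv q0 q1; set l := rate_lambda T n; set m := rate_mu T n.+1.
set x := complex.Re (f (mxunit R n n)); set y := complex.Re (f (mxunit R n.+1 n.+1)).
have l0 : 0 < l by exact: lam0.
have y0 : 0 <= y by exact: lstate_unit_ge0.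
have s0 : 0 < 1 - q by rewrite subr_gt0.
set e := sqmod (rate_eta T n) => he.
(* The solution of [1 - tau q = (1 + tau) q], so that the common factor cancels at the end;
   [tau ^+ 2 * q] is then [(1 - q)^2 / (4 q)], the form in which the threshold enters. *)
pose tau := (1 - q) / (2 * q).
have t0 : 0 < tau by rewrite divr_gt0// mulr_gt0.
have he' : e <= tau ^+ 2 * q * (l * m).
  have -> : e = (1 - q) ^+ 2 / (4 * q) * (q / (1 - q) ^+ 2 * (4 * e)).
    by field; rewrite !gt_eqF.
  have -> : tau ^+ 2 * q = (1 - q) ^+ 2 / (4 * q) by rewrite /tau; field; rewrite gt_eqF.
  by rewrite ler_pM2l// divr_gt0 ?exprn_gt0 ?mulr_gt0.
have := flow_bound hT (- (l * tau)) 1 sf inv.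
rewrite -/l -/m -/x -/y -/e mulr1 expr1n mul1r => fl.
have ey := ler_wpM2r y0 he'.
have : l * tau * (- (l * x - m * y)) <= l * tau * (l * tau * x + tau * q * m * y).
  apply: le_trans (_ : (- (l * tau)) ^+ 2 * x + tau ^+ 2 * q * (l * m) * y <= _); last first.
    by rewrite le_eqVlt; apply/orP; left; apply/eqP; ring.
  by move: fl ey; lra.
rewrite (ler_pM2l (mulr_gt0 l0 t0)) => h.
have h2 : (1 - tau * q) * (m * y) <= (1 + tau) * (l * x) by lra.
move: h2; have -> : 1 - tau * q = (1 + tau) * q by rewrite /tau; field; rewrite gt_eqF.
by rewrite -[X in X <= _]mulrA ler_pM2l ?mulrA// addr_gt0.
Qed.

End Weights.

Theorem theorem7 (R : realType) (T : {linear bop R -> bop R}) (hT : is_qbdc T) :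
  ((forall k : nat, rate_lambda T k != 0) ->
   (forall k : nat, (1 <= k)%N -> rate_mu T k != 0) ->
   (0 < kappa T)%E ->
   (expeR (- kappa T) / (1 - expeR (- kappa T)) ^+ 2 <
    limn_einf (fun n => (rate_lambda T n * rate_mu T n.+1)%:E /
                        (4 * sqmod (rate_eta T n))%:E))%E ->
   exists phi : {scalar bop R},
     [/\ is_normal_state phi, invariant_state T phi & exponential_falloff phi])
  /\
  ((forall n : nat, rate_lambda T n != 0) ->
   (exists2 m : nat, (1 <= m)%N & forall n : nat, (m < n)%N -> rate_mu T n < rate_lambda T n) ->
   (1 < limn_einf (fun n =>
          ((rate_lambda T n - rate_mu T n) * (rate_lambda T n.+1 - rate_mu T n.+1))%:E /
          (4 * sqmod (rate_eta T n))%:E))%E ->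
   ~ exists phi : {scalar bop R}, is_normal_state phi /\ invariant_state T phi).
Proof.
have eta0 n : 0 <= 4 * sqmod (rate_eta T n) by rewrite mulr_ge0 ?sqmod_ge0.
split.
  move=> lam0 mu0 k0 kL.
  have lamp n : 0 < rate_lambda T n by rewrite lt_neqAle eq_sym lam0 (rate_lambda_ge0 hT).
  have mup n : 0 < rate_mu T n.+1 by rewrite lt_neqAle eq_sym mu0 ?(rate_mu_ge0 hT).
  have [q1 [q [q10 q1q qlt1 q1k qL]]] := kappa_slack k0 kL.
  have q0 : 0 < q by exact: lt_trans q1q.
  have [N1 hN1] := weight_le lamp mup q10 q1k.
  have [N2 hN2] := limn_einf_near qL.
  have [n N0n|c [r [c0 r0 r1 decay]]] := @ratio_decay R q1 q (weight T) (rate_lambda T)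
    (fun n => rate_mu T n.+1) (maxn N1 N2) q10 q1q qlt1 (weight_gt0 lamp mup) _
    lamp mup (weight_recr mup).
    by apply: hN1; exact: leq_trans (leq_maxl _ _) N0n.
  apply: (exists_invariant_state hT c0 r0 r1) => N f sf fi fN.
  apply: (decay N (fun n => complex.Re (f (mxunit R n n)))).
  - by move=> n; rewrite lstate_unit_ge0// lstate_unit_le1.
  - move=> n N0n nN; apply: (rate_contraction hT lamp) => //; first exact: fi.
    apply: quotient_gt; rewrite ?eta0//; first by rewrite mulr_ge0 ?ltW.
    by apply: hN2; exact: leq_trans (leq_maxr _ _) N0n.
  - by move=> n; exact: lstate_unit_out.
move=> lam0 [m m1 mul] /limn_einf_near[N hN] [phi [nphi iphi]].
apply: (normal_state_unit_neq0 nphi).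
have sf := is_state_linear nphi.1.
apply: (@invariant_units_eq0 R T hT phi (maxn m.+1 N)) => //.
  by move=> n; rewrite geq_max => /andP[mn _]; exact: mul.
move=> n; rewrite geq_max => /andP[mn Nn].
rewrite -[leLHS]mul1r; apply: quotient_gt; rewrite ?eta0//; last exact: hN.
by rewrite mulr_ge0// subr_ge0 ltW// mul// ltnW.
Qed.
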